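(* Let $K_1,K_2$ be convex hypersurfaces in the sphere $S^n$ in good position, bounding open convex sets $I_1,I_2\subset S^n$, let $\Omega=S^n\setminus(\overline{K_1}\cup\overline{K_2})$ with its partial order $<$, let $F_1^2$ be the timelike spherical relative Funk distance, and let $\delta_1^2$ be the timelike intrinsic distance defined by the functional $f_{F_1^2}$. Then for every pair $(p,q)\in\Omega\times\Omega$ with $p\le q$, \[ F_1^2(p,q)=\delta_1^2(p,q). \]
   Context: $S^n$ carries its standard Riemannian metric $\langle\cdot,\cdot\rangle$ of curvature 1, with distance $d$. A convex subset of $S^n$ is a subset $I\neq S^n$ such that for all $x,y\in I$ every shortest geodesic joining them lies in $I$. $I_1,I_2$ are nonempty open convex sets, $K_i=\partial I_i$, $\overline{K_i}=I_i\cup K_i$. They are in good position if $\overline{K_1}\cap\overline{K_2}=\emptyset$ and, for any great circle $C$ meeting both $K_1$ and $K_2$, the set $C\setminus(\overline{K_1}\cup\overline{K_2})$ is the union of two arcs of length $<\pi$. A supporting hyperplane of $K_i$ is a great hypersphere $\pi$ (totally geodesic $(n-1)$-sphere) with $\pi\cap K_i\neq\emptyset$ and such that $I_i$ is contained in one component of $S^n\setminus\pi$. $\mathcal{P}_2(p)$ is the set of supporting hyperplanes $\pi$ of $K_2$ such that $p$ and $I_2$ lie in different components of $S^n\setminus\pi$. Order: $p<q$ (for distinct $p,q\in\Omega$) means there is a great circle arc $]a_1,a_2[\subset\Omega$ with $a_1\in K_1$, $a_2\in K_2$, not contained in any supporting hyperplane of $K_1$ or $K_2$, containing $p,q$, with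 $a_1,p,q,a_2$ in that order. $p\le q$ means $p<q$ or $p=q$. $\mathfrak{I}_2^+(p)=\{q\in\Omega: p<q\}$. Distance: for $p<q$, $F_1^2(p,q)=\log\frac{\sin d(p,b(p,q))}{\sin d(q,b(p,q))}$, where $b(p,q)=a_2$ is the first point of $K_2$ on the geodesic ray from $p$ through $q$; $F_1^2(p,p)=0$. Functional: $C_2^+(p)\subset T_p\Omega$ consists of $0$ and the nonzero $v$ such that $\exp_p(tv)\in\mathfrak{I}_2^+(p)$ for some $t>0$ with $t\|v\|<\pi$. For nonzero $v\in C_2^+(p)$, $f_{F_1^2}(p,v)=\inf_{\pi\in\mathcal{P}_2(p)}\frac{\langle v,\eta_\pi\rangle}{\tan d(p,\pi)}$, where $\eta_\pi$ is the unit tangent vector at $p$ perpendicular to $\pi$ (i.e. the initial direction of the shortest geodesic from $p$ to $\pi$), and the quotient is taken to be $0$ when $d(p,\pi)=\pi/2$; $f_{F_1^2}(p,0)=0$. Intrinsic distance: a piecewise $C^1$ curve $\sigma:[0,1]\to\Omega$ is timelike if $\sigma'(t)\in C_2^+(\sigma(t))$ for all $t$ (both one-sided derivatives at break points). $\delta_1^2(p,q)=\sup_\sigma\int_0^1 f_{F_1^2}(\sigma(t),\sigma'(t))\,dt$ over timelike piecewise $C^1$ curves $\sigma:[0,1]\to\Omega$ with $\sigma(0)=p$, $\sigma(1)=q$. *)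

(* Defs.v *)
From HB Require Import structures.
From mathcomp Require Import all_boot all_order all_algebra.
From mathcomp Require Import all_classical all_reals all_analysis.
Import Order.TTheory GRing.Theory Num.Theory.
Import numFieldNormedType.Exports.

Set Implicit Arguments.
Unset Strict Implicit.
Unset Printing Implicit Defensive.

Local Open Scope classical_set_scope.
Local Open Scope ring_scope.

(* S^n is the unit sphere of the Euclidean space of row vectors with n + 1
   coordinates; subsets of S^n are sets of such vectors. *)
Section Sphere.
Context {R : realType} {n : nat}.
Local Notation E := 'rV[R]_n.+1.
Implicit Types (p q x y u v w : E) (A C I K P : set E) (s : R -> E).

Definition dot x y : R := \sum_i x ord0 i * y ord0 i.

(* The library norm `|x| on row vectors is the sup norm, not this one. *)
Definition enorm x : R := Num.sqrt (dot x x).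

Definition sphere : set E := [set x | dot x x = 1].

Definition dist x y : R := acos (dot x y).

Definition dist_set x A : R := inf [set dist x y | y in A].

Definition tangent x : set E := [set v | dot x v = 0].

Definition unit_tangent x : set E := [set w | tangent x w /\ dot w w = 1].

(* The unit-speed geodesic from x with initial velocity w, when
   unit_tangent x w. *)
Definition geod x w (t : R) : E := cos t *: x + sin t *: w.

Definition sexp x v : E := geod x ((enorm v)^-1 *: v) (enorm v).

Definition sconvex I := [/\ I `<=` sphere, I <> sphere &
  forall x y w, I x -> I y -> unit_tangent x w -> geod x w (dist x y) = y ->
    forall t, 0 <= t <= dist x y -> I (geod x w t)].

Definition sopen I := exists2 U : set E, open U & I = U `&` sphere.

(* The sphere is closed in E, so the ambient closure is the closure in S^n. *)
Definition sboundary I : set E := closure I `&` closure (sphere `\` I).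

Definition sclosure I : set E := I `|` sboundary I.

Definition great_circle C := exists x w,
  [/\ sphere x, unit_tangent x w & C = range (geod x w)].

Definition arc x w (l : R) : set E := geod x w @` `]0, l[.

(* A is an open great circle arc of length l (l < 2 pi makes it embedded). *)
Definition is_arc A (l : R) := exists x w,
  [/\ sphere x, unit_tangent x w, 0 < l < pi *+ 2 & A = arc x w l].

Definition great_hypersphere P := exists2 u,
  sphere u & P = [set x | sphere x /\ dot x u = 0].

Definition supporting I P := [/\ great_hypersphere P,
  P `&` sboundary I !=set0 &
  exists2 x, (sphere `\` P) x & I `<=` connected_component (sphere `\` P) x].

Definition separating I p P := [/\ supporting I P, (sphere `\` P) p &
  connected_component (sphere `\` P) p `&` I = set0].

(* The initial velocity of a unit-speed shortest geodesic from p to P; unique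
   when 0 < dist_set p P < pi / 2. *)
Definition normal_dir p P w :=
  unit_tangent p w /\ P (geod p w (dist_set p P)).

Definition toward p q : E :=
  let v := q - dot p q *: p in (enorm v)^-1 *: v.

Definition first_hit K p q : E := geod p (toward p q)
  (inf [set t | 0 < t /\ K (geod p (toward p q) t)]).

Definition is_rderiv s (t : R) v :=
  h^-1 *: (s (t + h) - s t) @[h --> 0^'+] --> v.

Definition is_lderiv s (t : R) v :=
  h^-1 *: (s (t + h) - s t) @[h --> 0^'-] --> v.

Definition C1_on s (a b : R) := exists g : R -> E,
  [/\ {within `[a, b], continuous g},
      forall t, a <= t < b -> is_rderiv s t (g t) &
      forall t, a < t <= b -> is_lderiv s t (g t)].

(* Continuity on [0, 1] follows from the one-sided derivatives of the pieces. *)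
Definition piecewise_C1 s := exists (k : nat) (b : nat -> R),
  [/\ b 0%N = 0, b k = 1 &
      forall i, (i < k)%N -> b i < b i.+1 /\ C1_on s (b i) (b i.+1)].

End Sphere.

Section TimelikeFunk.
Context {R : realType} {n : nat}.
Local Notation E := 'rV[R]_n.+1.
Variables I1 I2 : set E.
Implicit Types (p q v w : E) (s : R -> E).

Definition good_position :=
  sclosure I1 `&` sclosure I2 = set0 /\
  forall C : set E, great_circle C ->
    C `&` sboundary I1 !=set0 -> C `&` sboundary I2 !=set0 ->
    exists A B l m, [/\ is_arc A l, is_arc B m, l < pi, m < pi &
      C `\` (sclosure I1 `|` sclosure I2) = A `|` B].

Definition Omega : set E := sphere `\` (sclosure I1 `|` sclosure I2).

Definition prec p q := exists a1 w (l t t' : R),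
  [/\ sboundary I1 a1, unit_tangent a1 w, l < pi *+ 2 &
      sboundary I2 (geod a1 w l)] /\
  [/\ arc a1 w l `<=` Omega,
      forall P, supporting I1 P \/ supporting I2 P -> ~ arc a1 w l `<=` P,
      [/\ 0 < t, t < t' & t' < l], p = geod a1 w t & q = geod a1 w t'].

Definition preceq p q := prec p q \/ p = q.

Definition future p : set E := [set q | Omega q /\ prec p q].

Definition funk p q : R :=
  if p == q then 0 else
  let b := first_hit (sboundary I2) p q in ln (sin (dist p b) / sin (dist q b)).

Definition cone p : set E := [set v | v = 0 \/
  [/\ tangent p v, v <> 0 &
      exists t, [/\ 0 < t, t * enorm v < pi & future p (sexp p (t *: v))]]].

Definition funk_quotients p v : set (\bar R) :=
  [set r | exists2 P, separating I2 p P &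
    if dist_set p P == pi / 2 then r = 0%E else
    exists2 w, normal_dir p P w & r = (dot v w / tan (dist_set p P))%:E].

Definition funk_functional p v : \bar R :=
  if v == 0 then 0%E else ereal_inf (funk_quotients p v).

Definition timelike s := forall t v,
  (0 <= t < 1 /\ is_rderiv s t v) \/ (0 < t <= 1 /\ is_lderiv s t v) ->
  cone (s t) v.

Definition timelike_curve p q : set (R -> E) := [set s |
  [/\ s 0 = p, s 1 = q, forall t, 0 <= t <= 1 -> Omega (s t),
      piecewise_C1 s & timelike s]].

(* The values of the derivative at 0, 1 and at the finitely many break points
   are irrelevant to the integral. *)
Definition funk_length s : \bar R :=
  (\int[lebesgue_measure]_(t in `[0%R, 1%R]) funk_functional (s t) (derive1 s t))%E.

Definition intrinsic_dist p q : \bar R :=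
  ereal_sup [set funk_length s | s in timelike_curve p q].

End TimelikeFunk.

(* Main.v *)
Require Import Defs.
From mathcomp Require Import all_boot all_order all_algebra.
From mathcomp Require Import all_classical all_reals all_analysis.
From mathcomp Require Import measurable_realfun ring lra.
Import Order.TTheory GRing.Theory Num.Theory.
Import numFieldNormedType.Exports.

Set Implicit Arguments.
Unset Strict Implicit.
Unset Printing Implicit Defensive.

Local Open Scope classical_set_scope.
Local Open Scope ring_scope.

(* A hyperplane u^perp supporting I2, with I2 on its negative side, contributes
   the quotient - <v, u> / <x, u> to the infimum defining f(x, v): along a curve
   this is minus the logarithmic derivative of <s, u>.

   Upper bound: take u supporting I2 at the endpoint b of the chord through p
   and q.  Along a timelike curve ending at q the function <s, u> stays positive
   (timelike vectors decrease <., u> on the hyperplane, and a Gronwall estimate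
   covers the points where the velocity vanishes), so the integral is at most
   ln (<p, u> / <q, u>), which equals F(p, q) because <., u> is a multiple of
   sin d(., b) on the chord.

   Lower bound: on the chord itself every supporting u satisfies <b, u> <= 0,
   which gives f(x, v) >= |v| cot d(x, b), and this integrates to F(p, q).

   Good position enters only to bound the length of a chord from K1 to K2
   by pi. *)
(** * Spherical geometry in coordinates *)

(** A hyperplane bounds the integral only while it keeps the moving point apart from [I2]; this is
    known at q but not along the curve, so positivity has to be carried backwards in time. The tool
    is a linear bound <v, u> <= C |v| <x, u>. It comes from the chord leaving x along v: the chord
    ends in the closure of [I2], which forces a slope of at most - cot c times <x, u>, where c is
    the arc length left to travel. This coefficient explodes only as c tends to pi, and since the
    whole chord has length at most pi, that would put x next to K1, which is excluded locally in
    Omega. The same slope inequality, read for all u at once, is the lower estimate of the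
    functional on a chord.

    The clause that no chord lies in a supporting hyperplane makes the multiple of sin d(., b)
    strictly positive, so its logarithm can be taken. For p = q no chord is given, and the upper
    bound becomes the statement that timelike loops have length at most 0. *)

Section Dot.
Context {R : realType} {n : nat}.
Local Notation E := 'rV[R]_n.+1.
Implicit Types (x y z u v w : E) (a b t : R).

Lemma dotC x y : dot x y = dot y x.
Proof. by apply: eq_bigr => i _; rewrite mulrC. Qed.

Lemma dotDl x y u : dot (x + y) u = dot x u + dot y u.
Proof. by rewrite /dot -big_split; apply: eq_bigr => i _; rewrite !mxE mulrDl. Qed.

Lemma dotZl a x u : dot (a *: x) u = a * dot x u.
Proof. by rewrite /dot mulr_sumr; apply: eq_bigr => i _; rewrite !mxE mulrA. Qed.

Lemma dotDr x y u : dot u (x + y) = dot u x + dot u y.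
Proof. by rewrite !(dotC u) dotDl. Qed.

Lemma dotZr a x u : dot u (a *: x) = a * dot u x.
Proof. by rewrite !(dotC u) dotZl. Qed.

Lemma dotNl x u : dot (- x) u = - dot x u.
Proof. by rewrite -scaleN1r dotZl mulN1r. Qed.

Lemma dotNr x u : dot u (- x) = - dot u x.
Proof. by rewrite !(dotC u) dotNl. Qed.

Lemma dot0l u : dot 0 u = 0.
Proof. by rewrite -(scale0r 0) dotZl mul0r. Qed.

Lemma dot0r u : dot u 0 = 0.
Proof. by rewrite dotC dot0l. Qed.

Definition dotE := (dotDl, dotDr, dotNl, dotNr, dotZl, dotZr).

Lemma dot_ge0 x : 0 <= dot x x.
Proof. by apply: sumr_ge0 => i _; rewrite -expr2 sqr_ge0. Qed.

Lemma sqr_coord_le x i : x ord0 i ^+ 2 <= dot x x.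
Proof.
rewrite /dot (bigD1 i)//= -expr2 lerDl.
by apply: sumr_ge0 => j _; rewrite -expr2 sqr_ge0.
Qed.

Lemma dot_eq0 x : dot x x = 0 -> x = 0.
Proof.
move=> x0; apply/rowP => i; rewrite mxE; apply/eqP.
by rewrite -sqrf_eq0 eq_le sqr_ge0 -x0 sqr_coord_le.
Qed.

Lemma dot_gt0 x : x <> 0 -> 0 < dot x x.
Proof.
move=> x0; rewrite lt_neqAle dot_ge0 andbT eq_sym.
by apply/negP => /eqP /dot_eq0.
Qed.

Lemma dot_cauchy_schwarz x y : dot x y ^+ 2 <= dot x x * dot y y.
Proof.
have [->|/eqP y0] := eqVneq y 0; first by rewrite dot0r dot0l expr0n mulr0.
have yy := dot_gt0 y0.
have := dot_ge0 (dot y y *: x - dot x y *: y).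
rewrite !dotE (dotC y x) => h.
have : 0 <= dot y y * (dot x x * dot y y - dot x y ^+ 2) by nra.
by rewrite pmulr_rge0// subr_ge0.
Qed.

Lemma dot_unit_le1 x y : dot x x = 1 -> dot y y = 1 -> -1 <= dot x y <= 1.
Proof.
move=> xx yy; have := dot_cauchy_schwarz x y; rewrite xx yy mul1r => h.
by rewrite -ler_norml -(@ler_pXn2r _ 2) ?nnegrE// expr1n real_normK ?num_real.
Qed.

Lemma enorm_ge0 x : 0 <= enorm x.
Proof. exact: sqrtr_ge0. Qed.

Lemma sqr_enorm x : enorm x ^+ 2 = dot x x.
Proof. by rewrite sqr_sqrtr// dot_ge0. Qed.

Lemma enorm_gt0 x : x <> 0 -> 0 < enorm x.
Proof. by move=> /dot_gt0; rewrite sqrtr_gt0. Qed.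

Lemma dot_normalize x : x <> 0 ->
  dot ((enorm x)^-1 *: x) ((enorm x)^-1 *: x) = 1.
Proof.
move=> x0; have := enorm_gt0 x0 => p0.
by rewrite !dotE -sqr_enorm; field; rewrite gt_eqF.
Qed.

Lemma continuous_coord (i : 'I_n.+1) : continuous (fun x : E => x ord0 i).
Proof. exact: coord_continuous. Qed.

Lemma cvg_dot (T : Type) (F : set_system T) (FF : Filter F) (f g : T -> E) x y :
  f t @[t --> F] --> x -> g t @[t --> F] --> y ->
  dot (f t) (g t) @[t --> F] --> dot x y.
Proof.
move=> fx gy; rewrite /dot.
apply: (@cvg_big _ _ +%R) => [|i _]; first exact: add_continuous.
apply: cvgM.
- exact: (cvg_comp _ _ fx (@continuous_coord i x)).
- exact: (cvg_comp _ _ gy (@continuous_coord i y)).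
Qed.

Lemma continuous_dotl u : continuous (fun x => dot x u).
Proof. by move=> x; exact: (@cvg_dot E (nbhs x) _ id (cst u) x u (cvg_id) (cvg_cst _)). Qed.

Lemma continuous_dotxx : continuous (fun x : E => dot x x).
Proof. by move=> x; exact: (@cvg_dot E (nbhs x) _ id id x x cvg_id cvg_id). Qed.

Lemma continuous_enorm : continuous (@enorm R n).
Proof.
move=> x; apply: (@continuous_comp _ _ _ (fun x => dot x x)).
  exact: continuous_dotxx.
exact: sqrt_continuous.
Qed.

Lemma closed_sphere : closed (sphere : set E).
Proof.
have -> : (sphere : set E) = (fun x => dot x x) @^-1` [set 1] by [].
apply: preimage_closed; first by move=> x _; exact: continuous_dotxx.
exact: closed_eq.
Qed.

Lemma sphere_neq0 x : sphere x -> x <> 0.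
Proof. by rewrite /sphere/= => + x0; rewrite x0 dot0l => /eqP; rewrite eq_sym oner_eq0. Qed.

(** Passes from Euclidean estimates to the sup norm, in which balls and bounded sets are
    expressed. *)
Lemma mxnorm_le_enorm x : `|x| <= enorm x.
Proof.
rewrite /Num.Def.normr/= mx_normrE (bigmax_le _ (enorm_ge0 x))//= => -[i j] _.
rewrite ord1 -ler_sqr ?nnegrE ?normr_ge0 ?enorm_ge0// real_normK ?num_real// sqr_enorm.
exact: sqr_coord_le.
Qed.

End Dot.

(** * Geodesics, closures and boundaries on the sphere *)

Section Geodesic.
Context {R : realType} {n : nat}.
Local Notation E := 'rV[R]_n.+1.
Implicit Types (x y z u v w : E) (a b s t : R).

Definition geod_velocity x w t : E := - sin t *: x + cos t *: w.

Lemma dot_geod x w t u : dot (geod x w t) u = cos t * dot x u + sin t * dot w u.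
Proof. by rewrite !dotE. Qed.

Lemma geod0 x w : geod x w 0 = x.
Proof. by rewrite /geod cos0 sin0 scale1r scale0r addr0. Qed.

(** Re-bases a great circle at another of its points; chords are moved along themselves in this
    way. *)
Lemma geod_shift x w t s :
  geod (geod x w t) (geod_velocity x w t) s = geod x w (t + s).
Proof. by apply/rowP => i; rewrite !mxE cosD sinD; ring. Qed.

Lemma dot_geod_geod x w s t : sphere x -> unit_tangent x w ->
  dot (geod x w s) (geod x w t) = cos (s - t).
Proof.
rewrite /sphere /unit_tangent /tangent/= => xx [xw ww].
by rewrite !dotE (dotC w x) xx ww xw cosB; ring.
Qed.

Lemma sphere_geod x w t : sphere x -> unit_tangent x w -> sphere (geod x w t).
Proof. by move=> xx xw; rewrite /sphere/= dot_geod_geod// subrr cos0. Qed.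

Lemma unit_tangent_geod x w t : sphere x -> unit_tangent x w ->
  unit_tangent (geod x w t) (geod_velocity x w t).
Proof.
rewrite /sphere /unit_tangent /tangent/= => xx [xw ww].
have := cos2Dsin2 t; rewrite !dotE (dotC w x) xx ww xw => h; split; first by ring.
by rewrite -[RHS]h; ring.
Qed.

Lemma continuous_geod x w : continuous (geod x w).
Proof.
move=> t; apply: cvgD; apply: cvgZr_tmp.
- exact: continuous_cos.
- exact: continuous_sin.
Qed.

Lemma sclosureE (I : set E) : I `<=` sphere -> sclosure I = closure I.
Proof.
move=> Is; apply/seteqP; split => x.
  by case=> [|[]//]; exact: subset_closure.
move=> clx; have [Ix|nIx] := pselect (I x); [by left|right; split => //].
apply: subset_closure; split => //.
by apply: closed_sphere; exact: closureS clx.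
Qed.

Lemma closed_sboundary (I : set E) : closed (sboundary I).
Proof. by apply: closedI; exact: closed_closure. Qed.

Lemma sboundary_sphere (I : set E) : I `<=` sphere -> sboundary I `<=` sphere.
Proof. by move=> Is x [clx _]; apply: closed_sphere; exact: closureS clx. Qed.

Lemma sopen_sboundary (I : set E) x : sopen I -> sboundary I x -> ~ I x.
Proof.
move=> [U oU ->] [_ cl] [Ux sx].
have [y [[sy nIy] Uy]] := cl _ (open_nbhs_nbhs (conj oU Ux)).
by apply: nIy.
Qed.

End Geodesic.

(** * Convex cones and separation *)

Section Cone.
Context {R : realType} {n : nat}.
Local Notation E := 'rV[R]_n.+1.
Implicit Types (x y z u v w : E) (a b s t : R) (D I : set E).

Definition convex_cone D :=
  (forall x y, D x -> D y -> D (x + y)) /\ (forall a x, 0 < a -> D x -> D (a *: x)).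

Lemma continuous_subl x : continuous (fun z : E => x - z).
Proof. by move=> z; apply: continuousB; [exact: cst_continuous|exact: cvg_id]. Qed.

Lemma continuous_subr x : continuous (fun z : E => z - x).
Proof. by move=> z; apply: continuousB; [exact: cvg_id|exact: cst_continuous]. Qed.

(** An element z of [D] close enough to y leaves x + y - z in the open set [D], and x + y is the sum
    of the two. *)
Lemma open_cone_closure D x y : open D -> convex_cone D -> D x -> closure D y ->
  D (x + y).
Proof.
move=> oD [addD _] Dx cly.
have near_y : nbhs y [set z | D (x + y - z)].
  have cf := @continuous_subl (x + y).
  by apply: cf; rewrite addrK; exact: open_nbhs_nbhs.
have [z [Dz /= Dxyz]] := cly _ near_y.
by rewrite -(subrK z (x + y)); exact: addD.
Qed.

(** If the value at x were 0, moving x by a small multiple of u would make it positive inside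
    [D]. *)
Lemma open_neg_dot D u : open D -> u <> 0 -> (forall x, D x -> dot x u <= 0) ->
  forall x, D x -> dot x u < 0.
Proof.
move=> oD u0 Du x Dx.
have cf : continuous (fun e : R => x + e *: u).
  by move=> e; apply: cvgD; [exact: cvg_cst|apply: cvgZr_tmp; exact: cvg_id].
have : nbhs (0 : R) [set e | D (x + e *: u)].
  by apply: cf; rewrite scale0r addr0; exact: open_nbhs_nbhs.
move=> /nbhs_ballP[e /= e0 De].
have /Du : D (x + (e / 2) *: u).
  by apply: De; rewrite /ball/= sub0r normrN gtr0_norm ?divr_gt0// gtr_pMr// invf_lt1// ltr1n.
rewrite !dotE => h; have := dot_gt0 u0 => uu.
by apply: lt_le_trans h; rewrite ltrDl mulr_gt0// divr_gt0.
Qed.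

(* The normal [u] points from the nearest point of [closure D] to [- d]. *)
Lemma open_cone_separation D : D !=set0 -> open D -> convex_cone D -> ~ D 0 ->
  exists2 u, u <> 0 & forall x, D x -> dot x u < 0.
Proof.
move=> [d Dd] oD cD D0.
have nDd : ~ closure D (- d).
  by move=> /(open_cone_closure oD cD Dd); rewrite subrr.
pose f z := dot (- d - z) (- d - z).
have cf : continuous f.
  by move=> z; have cz := @continuous_subl (- d) z; exact: (cvg_dot _ cz cz).
(* Cutting the closure by the ball around - d through d makes it compact, so a nearest point
   exists. *)
pose A := closure D `&` [set z | f z <= f d].
have Ad : A d by split; [exact: subset_closure|exact: lexx].
have closedA : closed A.
  apply: closedI; first exact: closed_closure.
  have -> : [set z | f z <= f d] = f @^-1` [set r | r <= f d] by [].
  by apply: preimage_closed; [move=> z _; exact: cf|exact: closed_le].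
have boundedA : bounded_set A.
  exists (`|d| + enorm (- d - d)); split; first by rewrite num_real.
  move=> M hM z [_ /= fz]; apply: le_trans (ltW hM).
  have : `|- d - z| <= enorm (- d - d).
    by apply: le_trans (mxnorm_le_enorm _) _; rewrite ler_sqrt// dot_ge0.
  have {2}-> : z = - (- d - z) - d by rewrite opprB opprK addrK.
  move: (- d - z) => y h; apply: le_trans (ler_normB _ _) _.
  by rewrite normrN addrC lerD2l.
have [z Az zmin] := EVT_min_rV (ex_intro _ d Ad)
  (bounded_closed_compact boundedA closedA) (continuous_subspaceT cf).
have /set_mem [clz fz] := Az.
have zmin' x : closure D x -> f z <= f x.
  move=> clx; have [fx|fx] := leP (f x) (f d); first by apply: zmin; rewrite inE.
  exact: le_trans fz (ltW fx).
pose u := - d - z.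
have u0 : u <> 0.
  by move/eqP; rewrite subr_eq0 => /eqP zd; apply: nDd; rewrite zd.
exists u => //; apply: open_neg_dot => // x Dx.
have [//|xu] := leP (dot x u) 0.
have x0 : x <> 0 by move=> x0; apply: D0; rewrite -x0.
have xx := dot_gt0 x0.
(* For this step length |u - e x|^2 = |u|^2 - e^2 |x|^2, so e x + z would be closer to - d than
   z. *)
pose e := dot x u / dot x x.
have e0 : 0 < e by rewrite divr_gt0.
have : f z <= f (e *: x + z).
  apply: zmin'; apply: subset_closure; apply: open_cone_closure => //.
  exact: cD.2.
have xuE : dot x u = e * dot x x by rewrite /e divfK// gt_eqF.
rewrite /f opprD [- (e *: x) - z]addrC addrA -/u.
move: u e {u0 xu} e0 xuE => u e e0 xuE.
rewrite !dotE (dotC u x) xuE => h; exfalso.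
have : 0 < e * (e * dot x x) by rewrite !mulr_gt0.
by nra.
Qed.

(** The radial cone turns spherical convexity into linear convexity, so that separation can be done
    in the ambient vector space. *)
Definition cone_over I : set E := [set y | exists a x, [/\ 0 < a, I x & y = a *: x]].

Lemma sub_cone_over I : I `<=` cone_over I.
Proof. by move=> x Ix; exists 1, x; rewrite scale1r. Qed.

Lemma cone_overE I y : I `<=` sphere ->
  cone_over I y <-> y <> 0 /\ I ((enorm y)^-1 *: y).
Proof.
move=> Is; split=> [[a [x [a0 Ix ->]]]|[y0 Iy]].
  have xx : dot x x = 1 := Is _ Ix.
  have -> : enorm (a *: x) = a.
    by rewrite /enorm !dotE xx mulr1 -expr2 sqrtr_sqr gtr0_norm.
  rewrite scalerA mulVf ?gt_eqF// scale1r; split => // /eqP.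
  by rewrite scaler_eq0 gt_eqF//= => /eqP; exact/sphere_neq0/Is.
have e0 := enorm_gt0 y0.
exists (enorm y), ((enorm y)^-1 *: y); split => //.
by rewrite scalerA divff ?gt_eqF// scale1r.
Qed.

Lemma open_cone_over I : I `<=` sphere -> sopen I -> open (cone_over I).
Proof.
move=> Is [U oU IU]; rewrite openE => y /(cone_overE _ Is) [y0 Iy].
have e0 := enorm_gt0 y0.
have cn : (enorm z)^-1 *: z @[z --> y] --> (enorm y)^-1 *: y.
  have ey0 : enorm y != 0 by rewrite gt_eqF.
  exact: (cvgZ (cvgV ey0 (@continuous_enorm R n y)) cvg_id).
have Uy : U ((enorm y)^-1 *: y) by move: Iy; rewrite IU => -[].
have h1 : \forall z \near y, U ((enorm z)^-1 *: z).
  by apply: cn; exact: open_nbhs_nbhs.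
have h2 : \forall z \near y, 0 < enorm z.
  exact: cvgr_gt (@continuous_enorm R n y) _ e0.
rewrite /interior/=; near=> z.
have z0 : z <> 0.
  move=> z0; have : 0 < enorm z by near: z.
  by rewrite z0 /enorm dot0l sqrtr0 ltxx.
apply/cone_overE => //; split => //; rewrite IU; split; first by near: z.
exact: dot_normalize.
Unshelve. all: by end_near. Qed.

Lemma geod_toward x y : sphere x -> sphere y -> -1 < dot x y < 1 ->
  [/\ unit_tangent x (toward x y), geod x (toward x y) (dist x y) = y &
      0 < dist x y < pi].
Proof.
move=> xx yy /andP[c1 c2].
have v2 : dot (y - dot x y *: x) (y - dot x y *: x) = 1 - dot x y ^+ 2.
  by rewrite !dotE xx yy (dotC y x); ring.
have s0 : 0 < 1 - dot x y ^+ 2 by nra.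
have v0 : y - dot x y *: x <> 0.
  by move=> v0; move: v2 s0; rewrite v0 dot0l => <-; rewrite ltxx.
have c : -1 <= dot x y <= 1 by rewrite !ltW.
split.
- split; last exact: dot_normalize.
  by rewrite /tangent/= /toward !dotE xx mulr1 subrr mulr0.
- rewrite /geod /dist /toward sin_acos// /enorm v2 acosK// scalerA divff.
    by rewrite scale1r addrC subrK.
  by rewrite gt_eqF// sqrtr_gt0.
- by rewrite /dist acos_gt0 ?acos_ltpi ?c1 ?c2 ?ltW.
Qed.

Lemma dot_unit_eq1 x y : sphere x -> sphere y -> dot x y = 1 -> x = y.
Proof.
move=> xx yy xy; apply/eqP; rewrite -subr_eq0; apply/eqP/dot_eq0.
by rewrite !dotE (dotC y x) xx yy xy; ring.
Qed.

Lemma dot_unit_eqN1 x y : sphere x -> sphere y -> dot x y = -1 -> y = - x.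
Proof.
move=> xx yy xy; apply: esym; apply: dot_unit_eq1 => //.
- by rewrite /sphere/= !dotE opprK; exact: xx.
- by rewrite dotNl xy opprK.
Qed.

(** Every point of the sphere lies on a half great circle from x to - x, which is a shortest
    geodesic; with both ends in [I], the set would be the whole sphere. *)
Lemma sconvex_antipode I x : sconvex I -> I x -> ~ I (- x).
Proof.
move=> [Is Ineq Iconv] Ix INx; apply: Ineq; apply/seteqP; split => // z zz.
have xx : sphere x := Is _ Ix.
have /andP[c1 c2] := dot_unit_le1 xx zz.
have [c|c] := eqVneq (dot x z) 1; first by rewrite -(dot_unit_eq1 xx zz c).
have [d|d] := eqVneq (dot x z) (-1); first by rewrite (dot_unit_eqN1 xx zz d).
have [|tw ez /andP[L0 Lpi]] := geod_toward xx zz.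
  by rewrite !lt_neqAle c1 c2 c eq_sym d.
rewrite -ez; move: (toward x z) (dist x z) tw L0 Lpi {ez} => w L tw L0 Lpi.
have dpi : dist x (- x) = pi by rewrite /dist dotNr xx acosN1.
apply: (Iconv _ _ _ Ix INx tw); last by rewrite dpi !ltW.
by rewrite dpi /geod cospi sinpi scale0r addr0 scaleN1r.
Qed.

(** In the plane of x and y, the vector a x + b y has norm N and a polar angle t between 0 and L =
    d(x, y), so it is N times a point of the shortest geodesic. Equal points are treated apart, and
    antipodal ones cannot occur. *)
Lemma convex_cone_over I : sconvex I -> convex_cone (cone_over I).
Proof.
move=> cI; have [Is Ineq Iconv] := cI.
split=> [_ _ [a [x [a0 Ix ->]]] [b [y [b0 Iy ->]]]|a _ a0 [b [x [b0 Ix ->]]]];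
  last by exists (a * b), x; rewrite mulr_gt0// scalerA.
have xx : sphere x := Is _ Ix; have yy : sphere y := Is _ Iy.
have /andP[c1 c2] := dot_unit_le1 xx yy.
have [c|c] := eqVneq (dot x y) 1.
  exists (a + b), x; split => //; first exact: addr_gt0.
  by rewrite -(dot_unit_eq1 xx yy c) scalerDl.
have [d|d] := eqVneq (dot x y) (-1).
  by exfalso; apply: (sconvex_antipode cI Ix); rewrite -(dot_unit_eqN1 xx yy d).
have [|tw ey /andP[L0 Lpi]] := geod_toward xx yy.
  by rewrite !lt_neqAle c1 c2 c eq_sym d.
have Iw := Iconv _ _ _ Ix Iy tw ey.
move: (toward x y) (dist x y) tw ey L0 Lpi Iw => w L tw ey L0 Lpi Iw.
have sL : 0 < sin L by rewrite sin_gt0_pi// L0 Lpi.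
pose v := a *: x + b *: y.
have vE : v = (a + b * cos L) *: x + (b * sin L) *: w.
  by rewrite /v -ey; apply/rowP => i; rewrite !mxE; ring.
have [xw ww] := tw.
have N2 : dot v v = (a + b * cos L) ^+ 2 + (b * sin L) ^+ 2.
  by rewrite vE !dotE xx ww (dotC w x) xw; ring.
have bs : 0 < b * sin L by rewrite mulr_gt0.
have v0 : v <> 0.
  move=> v0; move: N2; rewrite v0 dot0l => /esym/eqP.
  by rewrite paddr_eq0 ?sqr_ge0// !sqrf_eq0 (gt_eqF bs) andbF.
have N0 := enorm_gt0 v0; set N := enorm v in N0.
have NN : N ^+ 2 = (a + b * cos L) ^+ 2 + (b * sin L) ^+ 2 by rewrite sqr_enorm.
have q1 : -1 <= (a + b * cos L) / N <= 1.
  rewrite -ler_norml normrM normfV (gtr0_norm N0) ler_pdivrMr// mul1r.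
  by rewrite -ler_sqr ?nnegrE ?normr_ge0 ?(ltW N0)// real_normK ?num_real// NN lerDl sqr_ge0.
pose t := acos ((a + b * cos L) / N).
have ct : cos t = (a + b * cos L) / N by rewrite acosK.
have st : sin t = b * sin L / N.
  rewrite sin_acos//; apply/eqP; rewrite -(@eqrXn2 _ 2)// ?sqrtr_ge0 ?divr_ge0 ?ltW//.
  have n0 : N != 0 by rewrite gt_eqF.
  have -> : 1 - ((a + b * cos L) / N) ^+ 2 = (b * sin L / N) ^+ 2.
    rewrite !expr_div_n; apply: (mulIf (x := N ^+ 2)); first by rewrite sqrf_eq0.
    by rewrite mulrBl !divfK ?sqrf_eq0// mul1r NN addrAC subrr add0r.
  by rewrite sqrtr_sqr real_normK ?num_real.
have /andP[t0 tpi] : 0 <= t <= pi by rewrite acos_ge0// acos_lepi.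
(* A larger angle would give 0 <= sin (t - L) = - a sin L / N < 0. *)
have tL : t <= L.
  have [//|Lt] := leP t L.
  have : 0 <= sin (t - L) by apply: sin_ge0_pi; rewrite subr_ge0 ltW//= lerBlDr ler_wpDr// ltW.
  have -> : sin (t - L) = - (a * sin L / N).
    by rewrite sinB st ct; field; rewrite gt_eqF.
  by rewrite oppr_ge0 leNgt divr_gt0// mulr_gt0.
exists N, (geod x w t); split => //.
  by apply: Iw; rewrite t0 tL.
rewrite -/v vE /geod scalerDr !scalerA ct st.
by rewrite [N * (_ / N)]mulrC divfK ?gt_eqF// [N * (_ / N)]mulrC divfK ?gt_eqF.
Qed.

Lemma cone_over_neq0 I : I `<=` sphere -> ~ cone_over I 0.
Proof. by move=> Is /(cone_overE _ Is)[]. Qed.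

End Cone.

(** * Supporting hyperspheres *)

Section Hyperplane.
Context {R : realType} {n : nat}.
Local Notation E := 'rV[R]_n.+1.
Implicit Types (x y z u v w : E) (a b s t : R) (P I : set E).

Definition hypersphere u : set E := [set x | sphere x /\ dot x u = 0].

(** [u] is the outward unit normal of a supporting hypersphere; fixing its sign replaces connected
    components by inequalities. *)
Definition supports I u := [/\ sphere u, forall x, I x -> dot x u < 0 &
  exists2 y, sboundary I y & dot y u = 0].

Lemma hypersphereN u : hypersphere (- u) = hypersphere u.
Proof.
apply/seteqP; split=> x [xx]; rewrite /hypersphere/= dotNr => xu; split => //.
- by move/eqP: xu; rewrite oppr_eq0 => /eqP.
- by rewrite xu oppr0.
Qed.

Lemma sphereN x : sphere x -> sphere (- x).
Proof. by rewrite /sphere/= dotNl dotNr opprK. Qed.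

(** A connected set that avoids the zeros of <., u> stays on one side; conversely the segment from x
    to y keeps <., u> positive, so it avoids 0 and can be normalized onto the sphere. *)
Lemma component_hemisphere u x : sphere x -> 0 < dot x u ->
  connected_component (sphere `\` hypersphere u) x =
  [set y | sphere y /\ 0 < dot y u].
Proof.
move=> xx xu; apply/seteqP; split => y.
  move=> [C [Cx Csub cC] Cy]; have [yy ny] := Csub _ Cy; split => //.
  have cC' : connected ((fun z => dot z u) @` C).
    apply: connected_continuous_connected => //.
    by apply: continuous_subspaceT; exact: continuous_dotl.
  have [//|yu] := ltP 0 (dot y u).
  have /connected_intervalP iC := cC'.
  have [z Cz z0] : ((fun z => dot z u) @` C) 0.
    apply: (iC (dot y u) (dot x u)); [by exists y|by exists x|].
    by rewrite yu (ltW xu).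
  by have [zz] := Csub _ Cz; apply: contra_notP => _; split.
move=> [yy yu].
pose f (t : R) := (1 - t) *: x + t *: y.
have fu t : 0 <= t <= 1 -> 0 < dot (f t) u.
  move=> /andP[t0 t1]; rewrite !dotE.
  have [t12|t12] := leP t (1 / 2); nra.
have f0 t : 0 <= t <= 1 -> f t <> 0.
  by move=> /fu + ft; rewrite ft dot0l ltxx.
have cf : continuous f.
  move=> t; apply: cvgD; apply: cvgZr_tmp; last exact: cvg_id.
  by apply: cvgB; [exact: cvg_cst|exact: cvg_id].
pose g t := (enorm (f t))^-1 *: f t.
have cg : {within `[0, 1], continuous g}.
  apply: continuous_in_subspaceT => t; rewrite inE/= in_itv/= => t01.
  apply: cvgZ; last exact: cf.
  apply: cvgV; first by rewrite gt_eqF// enorm_gt0//; exact: f0.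
  by apply: (continuous_comp (cf t)); exact: continuous_enorm.
have en1 z : sphere z -> enorm z = 1 by rewrite /sphere/= /enorm => ->; rewrite sqrtr1.
exists (g @` `[0, 1]).
  split; last by apply: connected_continuous_connected => //; exact: segment_connected.
  - exists 0; first by rewrite /= in_itv/= lexx ler01.
    by rewrite /g /f subr0 scale0r addr0 scale1r en1// invr1 scale1r.
  - move=> _ [t /= + <-]; rewrite in_itv/= => t01; split.
      exact/dot_normalize/f0.
    move=> [_]; rewrite dotZl => /eqP; rewrite mulf_eq0 invr_eq0.
    by rewrite !gt_eqF ?fu// enorm_gt0//; exact: f0.
exists 1; first by rewrite /= in_itv/= lexx ler01.
by rewrite /g /f subrr scale0r add0r scale1r en1// invr1 scale1r.
Qed.

Lemma component_side u x y : sphere x -> dot x u != 0 ->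
  connected_component (sphere `\` hypersphere u) x y ->
  exists2 e : bool, 0 < (-1) ^+ e * dot x u & 0 < (-1) ^+ e * dot y u.
Proof.
move=> xx; rewrite neq_lt => /orP[xu|xu].
  rewrite -hypersphereN component_hemisphere// ?dotNr ?oppr_gt0// => -[_ yu].
  by exists true; rewrite expr1 mulN1r; [rewrite oppr_gt0|rewrite -dotNr].
by rewrite component_hemisphere// => -[_ yu]; exists false; rewrite mul1r.
Qed.

Lemma supporting_hypersphere I u : I `<=` sphere -> I !=set0 -> supports I u ->
  supporting I (hypersphere u).
Proof.
move=> Is [x Ix] [uu Iu [y Iy yu]]; split.
- by exists u.
- by exists y; split => //; split => //; exact: (sboundary_sphere Is).
- exists x; first by split; [exact: Is|move=> [_]; move: (Iu _ Ix) => + h; rewrite h ltxx].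
  rewrite -hypersphereN component_hemisphere ?dotNr ?oppr_gt0; [|exact: Is|exact: Iu].
  by move=> z Iz; split; [exact: Is|rewrite dotNr oppr_gt0; exact: Iu].
Qed.

(** The normal is oriented to be negative on [I]; then x must be on the positive side, since a
    hemisphere containing both x and [I] would be the component of x. *)
Lemma separatingP I x P : I `<=` sphere -> I !=set0 -> sphere x ->
  separating I x P <->
  exists u, [/\ supports I u, 0 < dot x u & P = hypersphere u].
Proof.
move=> Is I0 xx; split=> [|[u [su xu ->]]]; last first.
  split; first exact: supporting_hypersphere.
    by split => // -[_ xu0]; rewrite xu0 ltxx in xu.
  rewrite component_hemisphere//; apply/seteqP; split => // y [[_ yu] Iy].
  by have [_ Iu _] := su; have := lt_trans yu (Iu _ Iy); rewrite ltxx.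
move=> [[[u uu ->] [y [[yy yu] Iy]] [z [zz nz] Iz]] [_ nx] xI].
suff [e [Ie xe]] : exists e : bool,
    (forall y, I y -> (-1) ^+ e * dot y u < 0) /\ 0 < (-1) ^+ e * dot x u.
  exists ((-1) ^+ e *: u); split; last first.
  - by case: (e); rewrite ?scale1r// expr1 scaleN1r hypersphereN.
  - by rewrite dotZr.
  split; last by exists y; rewrite // dotZr yu mulr0.
  - by case: (e); rewrite ?scale1r// expr1 scaleN1r; exact: sphereN.
  - by move=> w /Ie; rewrite dotZr.
have zu : dot z u != 0 by apply/eqP => zu; apply: nz.
have xu : dot x u != 0 by apply/eqP => xu; apply: nx.
have [e ze] : exists e : bool, 0 < (-1) ^+ e * dot z u.
  move: zu; rewrite neq_lt => /orP[h|h]; first by exists true; rewrite mulN1r oppr_gt0.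
  by exists false; rewrite mul1r.
have sgn (a b : R) (d : bool) : 0 < (-1) ^+ d * a -> 0 < (-1) ^+ e * a ->
    0 < (-1) ^+ d * b -> 0 < (-1) ^+ e * b.
  case: d; case: e {ze} => //; rewrite ?expr1 ?expr0 ?mul1r ?mulN1r ?oppr_gt0 => h1 h2.
    by have := lt_trans h1 h2; rewrite ltxx.
  by have := lt_trans h1 h2; rewrite ltxx.
have Ie y' : I y' -> 0 < (-1) ^+ e * dot y' u.
  move=> /Iz /(component_side zz zu) [d zd yd]; exact: sgn zd ze yd.
(* [e] is the sign that makes the form positive on [I]; [supports] asks for the opposite one. *)
exists (~~ e).
have signN : (-1) ^+ (~~ e) = - (-1) ^+ e :> R by case: (e); rewrite ?opprK.
split; first by move=> y' /Ie; rewrite signN mulNr oppr_lt0.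
rewrite signN mulNr oppr_gt0 lt_neqAle mulf_eq0 signr_eq0 (negbTE xu)/=.
rewrite leNgt; apply/negP => xe.
have [i Ii] := I0.
have : (connected_component (sphere `\` hypersphere u) x `&` I) i.
  split => //; case: e Ie {ze sgn signN} xe => [|] Ie.
    rewrite expr1 mulN1r oppr_gt0 => xe.
    rewrite -hypersphereN component_hemisphere ?dotNr ?oppr_gt0//.
    by split; [exact: Is|have := Ie _ Ii; rewrite expr1 mulN1r dotNr].
  rewrite expr0 mul1r => xe; rewrite component_hemisphere//.
  by split; [exact: Is|have := Ie _ Ii; rewrite expr0 mul1r].
by rewrite xI.
Qed.

(** By Cauchy-Schwarz, <x, y> on the hypersphere is at most the norm of the projection x - <x, u> u,
    and the normalized projection attains it. Nonemptiness excludes n = 0, where the infimum of the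
    empty set is a default value. *)
Lemma dist_hypersphere x u : sphere x -> sphere u -> 0 < dot x u ->
  hypersphere u !=set0 ->
  dist_set x (hypersphere u) = acos (Num.sqrt (1 - dot x u ^+ 2)).
Proof.
move=> xx uu xu [y0 [yy0 yu0]].
have /andP[_ xu1] := dot_unit_le1 xx uu.
set g := dot x u in xu xu1 *; pose c := Num.sqrt (1 - g ^+ 2).
have g2 : 0 <= 1 - g ^+ 2 by nra.
have c0 : 0 <= c by exact: sqrtr_ge0.
have c2 : c ^+ 2 = 1 - g ^+ 2 by rewrite sqr_sqrtr.
have gc : 1 - g * g = c * c by rewrite -!expr2 c2.
have c1 : c <= 1 by nra.
have cle y : hypersphere u y -> dot x y <= c.
  move=> [yy yu]; have := dot_cauchy_schwarz (x - g *: u) y.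
  have -> : dot (x - g *: u) y = dot x y by rewrite !dotE (dotC u y) yu; ring.
  have -> : dot (x - g *: u) (x - g *: u) = c ^+ 2.
    by rewrite !dotE xx uu (dotC u x) -/g c2; ring.
  rewrite yy mulr1 => h; apply: le_trans (ler_norm _) _.
  by rewrite -ler_sqr ?nnegrE// real_normK ?num_real.
have [y [yy yu] yc] : exists2 y, hypersphere u y & dot x y = c.
  (* If the projection of x vanishes it cannot be normalized, but then x is orthogonal to the whole
     hypersphere and any point of it will do. *)
  have [c00|cn0] := eqVneq c 0.
    exists y0 => //; have := dot_cauchy_schwarz (x - g *: u) y0.
    have -> : dot (x - g *: u) y0 = dot x y0 by rewrite !dotE (dotC u) yu0; ring.
    have -> : dot (x - g *: u) (x - g *: u) = c ^+ 2.
      by rewrite !dotE xx uu (dotC u x) -/g c2; ring.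
    rewrite c00 expr0n mul0r => h; apply/eqP.
    by rewrite -sqrf_eq0 eq_le h sqr_ge0.
  exists (c^-1 *: (x - g *: u)); last first.
    by rewrite !dotE xx -/g; apply: (mulfI cn0); rewrite mulVKf// -expr2 c2; ring.
  split.
    rewrite /sphere/= !dotE xx uu (dotC u x) -/g.
    by transitivity ((1 - g * g) / (c * c)); [by field|rewrite gc divff// mulf_neq0].
  by rewrite !dotE uu -/g; ring.
rewrite /dist_set; apply/eqP; rewrite eq_le; apply/andP; split.
  apply: ge_inf; last by exists y => //; rewrite /dist yc.
  exists 0 => _ [z [zz _] <-].
  by apply: acos_ge0; exact: dot_unit_le1.
apply: lb_le_inf; first by exists (dist x y); exists y.
move=> _ [z hz <-]; have [zz zu] := hz.
have zc := dot_unit_le1 xx zz.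
rewrite leNgt; apply/negP => h.
have : cos (acos c) < cos (dist x z).
  rewrite ltr_cos// ?in_itv/= ?acos_ge0 ?acos_lepi//.
  - by rewrite c1 (le_trans _ c0)// lerN10.
  - by rewrite c1 (le_trans _ c0)// lerN10.
rewrite !acosK//; last by rewrite in_itv/= c1 (le_trans _ c0)// lerN10.
by rewrite ltNge cle.
Qed.

(** With d the distance to the hypersphere, <x, u> = sin d and the normal direction is w = - (u -
    <x, u> x) / cos d, so <v, w> / tan d = - <v, u> / <x, u>. At d = pi/2 one has x = u, and
    tangency of v makes this quotient equal to the prescribed value 0. *)
Lemma funk_quotientsP I x v r : I `<=` sphere -> I !=set0 -> sphere x ->
  tangent x v ->
  funk_quotients I x v r <->
  exists u, [/\ supports I u, 0 < dot x u & r = (- dot v u / dot x u)%:E].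
Proof.
move=> Is I0 xx xv.
have main u : supports I u -> 0 < dot x u ->
    (if dist_set x (hypersphere u) == pi / 2 then r = 0%E else
      exists2 w, normal_dir x (hypersphere u) w &
        r = (dot v w / tan (dist_set x (hypersphere u)))%:E) <->
    r = (- dot v u / dot x u)%:E.
  move=> [uu _ [y Iy yu]] xu.
  have [xuw xu1] : -1 <= dot x u /\ dot x u <= 1 by apply/andP; exact: dot_unit_le1.
  have Hy : hypersphere u !=set0.
    by exists y; split => //; exact: sboundary_sphere Iy.
  have g2 : 0 <= 1 - dot x u ^+ 2 by nra.
  rewrite /normal_dir dist_hypersphere//.
  set c := Num.sqrt _.
  have c0 : 0 <= c by exact: sqrtr_ge0.
  have c2 : c ^+ 2 = 1 - dot x u ^+ 2 by rewrite sqr_sqrtr.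
  have gc : 1 - dot x u * dot x u = c * c by rewrite -!expr2 c2.
  have c11 : -1 <= c <= 1 by apply/andP; split; nra.
  have cosc : cos (acos c) = c by rewrite acosK.
  have sinc : sin (acos c) = dot x u.
    by rewrite sin_acos// c2 opprB addrC subrK sqrtr_sqr gtr0_norm.
  have [h|h] := eqVneq (acos c) (pi / 2).
    have cc : c = 0 by rewrite -cosc h cos_pihalf.
    have xu' : dot x u = 1 by rewrite -sinc h sin_pihalf.
    have <- : x = u by exact: dot_unit_eq1.
    by rewrite (dotC v) xv oppr0 mul0r.
  have cn0 : c != 0.
    by apply: contra_neq h => ->; rewrite acos0.
  have dw w : normal_dir x (hypersphere u) w ->
      dot v w / tan (acos c) = - dot v u / dot x u.
    rewrite /normal_dir dist_hypersphere// -/c => -[[xw ww] [_]].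
    rewrite dot_geod cosc sinc => wu.
    have {}wu : dot w u = - c.
      by apply: (mulfI (lt0r_neq0 xu)); move: wu; rewrite mulrC; lra.
    (* Both sides are unit vectors, and <w, u> = - c forces their inner product to be 1. *)
    have -> : w = - c^-1 *: (u - dot x u *: x).
      apply/eqP; rewrite -subr_eq0; apply/eqP/dot_eq0.
      rewrite scaleNr opprK; set y' := c^-1 *: _.
      have wy : dot w y' = -1.
        by rewrite !dotE wu (dotC w x) xw mulr0 subr0 mulrN mulVf.
      have yy' : dot y' y' = 1.
        rewrite !dotE uu xx (dotC u x).
        by transitivity ((1 - dot x u * dot x u) / (c * c)); [by field|rewrite gc divff// mulf_neq0].
      by clearbody y'; rewrite !dotE ww (dotC y' w) wy yy'; ring.
    rewrite !dotE (dotC v x) xv mulr0 subr0 /tan cosc sinc.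
    by field; rewrite cn0 gt_eqF.
  split=> [[w wn ->]|->].
    by rewrite dw// /normal_dir dist_hypersphere.
  suff [w wn] : exists w, normal_dir x (hypersphere u) w.
    by exists w; [move: wn; rewrite /normal_dir dist_hypersphere|rewrite dw].
  exists (- c^-1 *: (u - dot x u *: x)).
  have ut : unit_tangent x (- c^-1 *: (u - dot x u *: x)).
    split; first by rewrite /tangent/= !dotE xx; ring.
    rewrite !dotE uu xx (dotC u x).
    by transitivity ((1 - dot x u * dot x u) / (c * c)); [by field|rewrite gc divff// mulf_neq0].
  split => //; rewrite dist_hypersphere// -/c; split; first exact: sphere_geod.
  rewrite dot_geod cosc sinc !dotE uu.
  by rewrite gc; field.
split.
  move=> [P /(separatingP _ Is I0 xx)[u [su xu ->]]] /(main _ su xu) ->.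
  by exists u.
move=> [u [su xu ru]]; exists (hypersphere u); last exact/main.
by apply/separatingP => //; exists u.
Qed.

End Hyperplane.

(** * Arcs joining the two boundaries *)

Section Arc.
Context {R : realType} {n : nat}.
Local Notation E := 'rV[R]_n.+1.
Implicit Types (a x y z u v w : E) (b s t l : R) (P I : set E).

Lemma cos_lt_norm (a b : R) : `|a| < b -> b <= pi -> cos b < cos a.
Proof.
move=> ab bpi.
have -> : cos a = cos `|a| by case: (ler0P a) => // _; rewrite cosN.
have a0 := normr_ge0 a.
have abW := ltW ab.
by rewrite ltr_cos ?in_itv/= ?a0 ?bpi ?(le_trans a0 abW) ?(le_trans abW bpi).
Qed.

Lemma geodD_pi x w t : geod x w (t + pi) = - geod x w t.
Proof. by rewrite /geod cosDpi sinDpi !scaleNr opprD. Qed.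

Lemma closed_geod_preimage x w (F : set E) : closed F -> closed (geod x w @^-1` F).
Proof. by apply: preimage_closed => t _; exact: continuous_geod. Qed.

(** * Good position makes a chord at most half a great circle *)

Section ArcLength.
Variables (I1 I2 : set E) (a w : E) (l : R).
Hypotheses (I1s : I1 `<=` sphere) (I2s : I2 `<=` sphere).
Hypotheses (disj : sclosure I1 `&` sclosure I2 = set0).
Hypotheses (aa : sphere a) (aw : unit_tangent a w) (l0 : 0 < l) (l2pi : l < pi *+ 2).
Hypotheses (a1 : sclosure I1 a) (a2 : sclosure I2 (geod a w l)).

(** An affine function vanishing, on the great circle, exactly at the two ends of the arc: it is
    positive on the open arc and negative on the complementary one. *)
Let phi x := dot x (geod a w (l / 2)) - cos (l / 2).

Let continuous_phi : continuous phi.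
Proof.
move=> y; apply: (@continuous_comp _ _ _ (fun x => dot x (geod a w (l / 2)))
  (fun r : R => r - cos (l / 2))); first exact: continuous_dotl.
exact: (cvgB cvg_id (cvg_cst _)).
Qed.

Let phi_geod s : phi (geod a w s) = cos (s - l / 2) - cos (l / 2).
Proof. by rewrite /phi dot_geod_geod. Qed.

Let phi_arc s : 0 < s < l -> 0 < phi (geod a w s).
Proof.
move=> /andP[s0 sl]; rewrite phi_geod subr_gt0 cos_lt_norm//.
  by rewrite ltr_norml; apply/andP; split; lra.
by move: l2pi; rewrite mulr2n => h; lra.
Qed.

Let phi_complement s : l < s < pi *+ 2 -> phi (geod a w s) < 0.
Proof.
rewrite mulr2n => /andP[s0 sl]; rewrite phi_geod subr_lt0 -ltrN2 -cosDpi.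
have -> : - cos (s - l / 2) = cos (s - l / 2 - pi).
  by rewrite -[in LHS](subrK pi (s - l / 2)) cosDpi opprK.
have -> : cos (l / 2 + pi) = cos (pi - l / 2).
  by rewrite cosDpi addrC cosDpi cosN.
by apply: cos_lt_norm; [rewrite ltr_norml; apply/andP; split; lra|rewrite gerBl divr_ge0// ltW].
Qed.

(** A zero lies at angle l / 2 on either side of the midpoint, so it is one of the two ends, which
    belong to the closures. *)
Let phi_neq0 s : phi (geod a w s) = 0 -> (sclosure I1 `|` sclosure I2) (geod a w s).
Proof.
move=> /eqP; rewrite phi_geod subr_eq0 => /eqP cc.
have E1 : geod a w s = geod (geod a w (l / 2)) (geod_velocity a w (l / 2)) (s - l / 2).
  by rewrite geod_shift addrCA subrr addr0.
have /eqP : sin (s - l / 2) ^+ 2 = sin (l / 2) ^+ 2 by rewrite !sin2cos2 cc.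
rewrite eqf_sqr => /orP[/eqP ss|/eqP ss].
- right; suff -> : geod a w s = geod a w l by [].
  have -> : geod a w l = geod (geod a w (l / 2)) (geod_velocity a w (l / 2)) (l / 2).
    by rewrite geod_shift -splitr.
  by rewrite E1 /geod cc ss.
- left; suff -> : geod a w s = a by [].
  have E0 : geod (geod a w (l / 2)) (geod_velocity a w (l / 2)) (- (l / 2)) = a.
    by rewrite geod_shift subrr geod0.
  by rewrite E1 -[RHS]E0 /(geod _ _ (s - _)) cc ss /(geod _ _ (- _)) cosN sinN.
Qed.

(** Otherwise the connected complementary arc would be covered by two disjoint closed sets, each
    containing one of its ends. *)
Let complement_hits : exists2 s, l < s < pi *+ 2 &
  ~ (sclosure I1 `|` sclosure I2) (geod a w s).
Proof.
apply: contrapT => nex.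
have hall s : l <= s <= pi *+ 2 -> (sclosure I1 `|` sclosure I2) (geod a w s).
  move=> /andP[]; rewrite !le_eqVlt => /predU1P[<- _|ls]; first by right.
  move=> /predU1P[->|sl].
    by left; rewrite mulr2n geodD_pi -[pi]add0r geodD_pi opprK geod0.
  by apply: contrapT => h; apply: nex; exists s => //; rewrite ls.
have nI x : sclosure I1 x -> ~ sclosure I2 x.
  by move=> h1 h2; have : (sclosure I1 `&` sclosure I2) x by []; rewrite disj.
pose J := `[l, pi *+ 2]%classic : set R.
have Jl : J l by rewrite /J/= in_itv/= lexx ltW.
have Jr : J (pi *+ 2) by rewrite /J/= in_itv/= lexx ltW.
have cJ : connected J by exact: segment_connected.
have JB : J `&` geod a w @^-1` sclosure I2 = J.
  apply: cJ.
  - by exists l.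
  - exists (~` (geod a w @^-1` sclosure I1)).
      by apply: closed_openC; apply: closed_geod_preimage; rewrite sclosureE//; exact: closed_closure.
    apply/seteqP; split=> s [Js h]; (split; first exact: Js).
      by move=> h1; exact: (nI _ h1 h).
    have hs : l <= s <= pi *+ 2 by move: Js; rewrite /J/= in_itv/=.
    have [h'|h'] := hall _ hs; [exfalso; exact: (h h')|exact: h'].
  - exists (geod a w @^-1` sclosure I2); last by [].
    by apply: closed_geod_preimage; rewrite sclosureE//; exact: closed_closure.
have : (J `&` geod a w @^-1` sclosure I2) (pi *+ 2) by rewrite JB.
move=> [_ /=]; rewrite mulr2n geodD_pi -[pi]add0r geodD_pi opprK geod0.
exact: nI.
Qed.

Let short_arcs (A B : set E) (m : R) s : is_arc A m -> (exists l', is_arc B l' /\ l' < pi) ->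
  range (geod a w) `\` (sclosure I1 `|` sclosure I2) = A `|` B ->
  Defs.arc a w l `<=` sphere `\` (sclosure I1 `|` sclosure I2) ->
  l < s < pi *+ 2 -> A (geod a w s) -> l <= pi.
Proof.
move=> [x [v [xx xv m0 AE]]] [l' [[y [v' [yy yv' _ BE]]] l'pi]] AB arcO sl As.
(* [A] is connected, has a point where phi is negative, and avoids the zeros of phi, which lie in
   the removed closures. *)
have Aphi z : A z -> phi z < 0.
  move=> Az; have cA : connected (phi @` A).
    apply: connected_continuous_connected.
      rewrite AE; apply: connected_continuous_connected.
        by apply/connected_intervalP; exact: interval_is_interval.
      by apply: continuous_subspaceT; exact: continuous_geod.
    by apply: continuous_subspaceT; exact: continuous_phi.
  have [//|z0] := ltP (phi z) 0.
  have /connected_intervalP iA := cA.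
  have [y' Ay' y'0] : (phi @` A) 0.
    apply: (iA (phi (geod a w s)) (phi z)); [by exists (geod a w s)|by exists z|].
    by rewrite z0 (ltW (phi_complement sl)).
  have : (A `|` B) y' by left.
  by rewrite -AB => -[[s' _ sE]]; rewrite -sE in y'0 * => /(_ (phi_neq0 y'0)).
have inB t : 0 < t < l -> B (geod a w t).
  move=> tl; have : (A `|` B) (geod a w t).
    rewrite -AB; split; first by exists t.
    by have [] : (sphere `\` (sclosure I1 `|` sclosure I2)) (geod a w t)
      by apply: arcO; exists t.
  by case=> // /Aphi; rewrite ltNge ltW// phi_arc.
rewrite leNgt; apply/negP => lpi.
have pi0 : 0 < pi :> R := pi_gt0 R.
(* These parameters are symmetric about l / 2 and pi apart; both lie in ]0, l[ because l > pi. *)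
have := inB ((l - pi) / 2); have := inB ((l - pi) / 2 + pi).
rewrite BE => /(_ _)[|s2 /= s2l e2]; first by apply/andP; split; lra.
move=> /(_ _)[|s1 /= s1l e1]; first by apply/andP; split; lra.
have : cos (s1 - s2) = -1 :> R.
  by rewrite -(dot_geod_geod _ _ yy yv') e1 e2 geodD_pi dotNr dot_geod_geod// subrr cos0.
have : -1 < cos (s1 - s2) :> R.
  rewrite -cospi; apply: cos_lt_norm => //.
  move: s1l s2l; rewrite !in_itv/= => /andP[? ?] /andP[? ?].
  by rewrite ltr_norml; apply/andP; split; lra.
by move=> + e; rewrite e ltxx.
Qed.

(* If [l] exceeded [pi], one of the two short arcs would lie on the far side of
   a line cutting off [arc a w l], so the other one would contain all of
   [arc a w l], hence a pair of antipodal points. *)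
Lemma arc_length_le_pi (A B : set E) (la lb : R) :
  is_arc A la -> is_arc B lb -> la < pi -> lb < pi ->
  range (geod a w) `\` (sclosure I1 `|` sclosure I2) = A `|` B ->
  Defs.arc a w l `<=` sphere `\` (sclosure I1 `|` sclosure I2) ->
  l <= pi.
Proof.
move=> Aarc Barc lapi lbpi AB arcO.
have [s sl ns] := complement_hits.
have : (A `|` B) (geod a w s) by rewrite -AB; split => //; exists s.
case=> h.
- by apply: (short_arcs Aarc _ AB arcO sl h); exists lb.
- by rewrite [A `|` B]setUC in AB; apply: (short_arcs Barc _ AB arcO sl h); exists la.
Qed.

End ArcLength.

(* [u] separates [I] from the half-plane spanned by [a] and [- v]. *)
Lemma boundary_support I a v : I !=set0 -> sopen I -> sconvex I ->
  sboundary I a -> unit_tangent a v ->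
  (forall e, 0 < e -> exists2 s, 0 < s < e & ~ I (geod a v (- s))) ->
  exists u, [/\ supports I u, dot a u = 0 & dot v u <= 0].
Proof.
move=> [x0 Ix0] oI cI Ia av hout; have [Is _ _] := cI.
set K := cone_over I.
have oK : open K by exact: open_cone_over.
have cK : convex_cone K by exact: convex_cone_over.
have K0 : ~ K 0 by exact: cone_over_neq0.
have aa : sphere a by exact: sboundary_sphere Ia.
have clKa : closure K a by have [cla _] := Ia; apply: closureS cla; exact: sub_cone_over.
(* [a] is only in the closure of the open cone [K], so it may be added to elements of [K] with
   nonnegative coefficients. *)
have Kadd k b : K k -> 0 <= b -> K (k + b *: a).
  move=> Kk; rewrite le_eqVlt => /predU1P[<-|b0]; first by rewrite scale0r addr0.
  have -> : k + b *: a = b *: (b^-1 *: k + a).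
    by rewrite scalerDr scalerA divff ?gt_eqF// scale1r.
  by apply: cK.2 => //; apply: open_cone_closure => //; apply: cK.2 => //; rewrite invr_gt0.
have nKa : ~ K a.
  move=> /(cone_overE _ Is)[_]; rewrite /enorm aa sqrtr1 invr1 scale1r.
  exact: sopen_sboundary Ia.
have nKNa b : ~ K (b *: a).
  move=> Kb; have [b0|b0] := leP b 0.
    have : K (b *: a + (- b) *: a) by apply: Kadd; rewrite // oppr_ge0.
    by rewrite scaleNr subrr.
  apply: nKa; have : K (b^-1 *: (b *: a)) by apply: cK.2 => //; rewrite invr_gt0.
  by rewrite scalerA mulVf ?gt_eqF// scale1r.
(* This is [K] minus the half-plane of all b a - c v with c >= 0; that 0 is not in [D] says that [K]
   misses the half-plane. *)
pose D := [set y | exists k b c, [/\ K k, 0 <= c & y = k + (b *: a + c *: v)]].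
have oD : open D.
  rewrite openE => y [k [b [c [Kk c0 ->]]]].
  set d := b *: a + c *: v.
  have : nbhs (k + d) [set z | K (z - d)].
    by apply: (@continuous_subr _ _ d); rewrite addrK; exact: open_nbhs_nbhs.
  apply: filterS => z /= Kz; exists (z - d), b, c; split => //.
  by rewrite -/d subrK.
have cD : convex_cone D.
  split=> [_ _ [k [b [c [Kk c0 ->]]]] [k' [b' [c' [Kk' c'0 ->]]]]|e _ e0 [k [b [c [Kk c0 ->]]]]].
    exists (k + k'), (b + b'), (c + c'); split; [exact: cK.1|exact: addr_ge0|].
    by apply/rowP => i; rewrite !mxE; ring.
  exists (e *: k), (e * b), (e * c); split; [exact: cK.2|by rewrite mulr_ge0// ltW|].
  by apply/rowP => i; rewrite !mxE; ring.
have D0 : ~ D 0.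
  move=> [k [b [c [Kk c0 /eqP]]]].
  rewrite eq_sym addr_eq0 opprD -!scaleNr => /eqP kE.
  move: c0; rewrite le_eqVlt => /predU1P[c0|c0].
    by move: kE Kk; rewrite -c0 oppr0 scale0r addr0 => ->; exact: nKNa.
  (* From r a - v = k / c + (r + b / c) a, this vector is in [K] as soon as r >= - b / c; [M] is a
     positive bound beyond that threshold. *)
  pose M := `|b| / c + 1.
  have M0 : 0 < M by rewrite ltr_wpDl// divr_ge0// ltW.
  have Kfar r : M <= r -> K (r *: a - v).
    move=> Mr; have -> : r *: a - v = c^-1 *: k + (r + b / c) *: a.
      by rewrite kE; apply/rowP => i; rewrite !mxE; field; rewrite gt_eqF.
    apply: Kadd; first by apply: cK.2 => //; rewrite invr_gt0.
    have : - b / c <= `|b| / c by rewrite ler_pM2r ?invr_gt0// -normrN ler_norm.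
    by move: Mr; rewrite /M mulNr; lra.
  (* cot e = M: for s < e the point sin s (cot s a - v) = [geod a v (- s)] would have cot s > M and
     lie in [K], against [hout]. *)
  pose e := pi / 2 - atan M.
  have e0 : 0 < e by rewrite subr_gt0; exact: atan_ltpi2.
  have [s /andP[s0 se] ns] := hout _ e0.
  have atM0 : 0 < atan M by rewrite -(atan0 R); exact: lt_atan.
  have s2 : 0 < s < pi / 2 by rewrite s0/= (lt_le_trans se)// gerBl ltW.
  have pi0 : 0 < pi :> R := pi_gt0 R.
  have ss : 0 < sin s.
    by apply: sin_gt0_pi; apply/andP; split => //; move: s2 => /andP[_]; lra.
  have cs : 0 < cos s.
    by apply: cos_gt0_pihalf; move: s2 => /andP[h1 h2]; apply/andP; split; lra.
  apply: ns.
  have : K (sin s *: (cos s / sin s *: a - v)).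
    apply: cK.2 => //; apply: Kfar.
    have -> : M = tan (pi / 2 - e) by rewrite /e opprB addrC subrK atanK.
    have -> : cos s / sin s = tan (pi / 2 - s).
      by rewrite /tan sinB cosB sin_pihalf cos_pihalf !mul0r !mul1r subr0 add0r.
    have /andP[_ s2'] := s2.
    have h1 : pi / 2 - e \in `](- (pi / 2)), (pi / 2)[%R.
      by rewrite in_itv/= /e opprB addrC subrK atan_gtNpi2 atan_ltpi2.
    have h2 : pi / 2 - s \in `](- (pi / 2)), (pi / 2)[%R.
      by rewrite in_itv/=; apply/andP; split; lra.
    by rewrite ltW// ltr_tan// ltrD2l ltrN2.
  have -> : sin s *: (cos s / sin s *: a - v) = geod a v (- s).
    rewrite /geod cosN sinN scalerBr scalerA mulrC divfK ?gt_eqF//.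
    by rewrite scaleNr.
  move=> /(cone_overE _ Is)[_]; rewrite /enorm.
  by have -> : dot _ _ = 1 := sphere_geod (- s) aa av; rewrite sqrtr1 invr1 scale1r.
have [u u0 Du] : exists2 u, u <> 0 & forall y, D y -> dot y u < 0.
  apply: open_cone_separation => //.
  by exists x0; exists x0, 0, 0; rewrite !scale0r !addr0; split => //; exact: sub_cone_over.
have Ku k : K k -> dot k u < 0.
  by move=> Kk; apply: Du; exists k, 0, 0; rewrite !scale0r !addr0.
have [k0 Kk0] : exists k, K k by exists x0; exact: sub_cone_over.
(* In [D] the coefficient of a takes both signs, which forces equality here; that of v is
   nonnegative, which gives only an inequality below. *)
have au : dot a u = 0.
  apply/eqP; apply: contrapT => /negP au.
  have : dot (k0 + (- dot k0 u / dot a u *: a + 0 *: v)) u < 0.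
    by apply: Du; exists k0, (- dot k0 u / dot a u), 0.
  by rewrite !dotE mul0r addr0 divfK// subrr ltxx.
have vu : dot v u <= 0.
  rewrite leNgt; apply/negP => vu.
  have : dot (k0 + (0 *: a + (- dot k0 u / dot v u) *: v)) u < 0.
    apply: Du; exists k0, 0, (- dot k0 u / dot v u); split => //.
    by rewrite divr_ge0 ?(ltW vu)// oppr_ge0 ltW// Ku.
  by rewrite !dotE mul0r add0r divfK ?gt_eqF// subrr ltxx.
have iu : 0 < (enorm u)^-1 by rewrite invr_gt0 enorm_gt0.
exists ((enorm u)^-1 *: u); split; first split.
- exact: dot_normalize.
- by move=> y /sub_cone_over /Ku yu; rewrite dotZr pmulr_rlt0.
- by exists a; rewrite // dotZr au mulr0.
- by rewrite dotZr au mulr0.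
- by rewrite dotZr pmulr_rle0.
Qed.

End Arc.

(** * Chords from K1 to K2, and the Funk functional along them *)

Section Chord.
Context {R : realType} {n : nat}.
Local Notation E := 'rV[R]_n.+1.
Variables I1 I2 : set E.
Hypotheses (I1s : I1 `<=` sphere) (I2_neq0 : I2 !=set0) (I2_open : sopen I2).
Hypotheses (I2_convex : sconvex I2) (good : good_position I1 I2).
Implicit Types (x y z u v w : E) (b c e r s t : R) (P : set E).

Let I2s : I2 `<=` sphere.
Proof. by have [] := I2_convex. Qed.

(** A chord seen from one of its interior points: b and c are the arc lengths back to K1 and on to
    K2. The bound b + c <= pi records what good position provides. *)
Definition chord x v (b c : R) :=
  [/\ [/\ sphere x, unit_tangent x v, 0 < b, 0 < c & b + c <= pi],
      sboundary I1 (geod x v (- b)), sboundary I2 (geod x v c),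
      forall s, - b < s < c -> Omega I1 I2 (geod x v s) &
      forall P, supporting I1 P \/ supporting I2 P ->
        ~ forall s, - b < s < c -> P (geod x v s)].

Lemma prec_chord x y : prec I1 I2 x y ->
  exists v b c r, [/\ chord x v b c, 0 < r < c & y = geod x v r].
Proof.
move=> [a [w [l [t [t' [[Ka aw l2pi Kl] [arcO nsup [t0 tt' t'l] -> ->]]]]]]].
have aa : sphere a := sboundary_sphere I1s Ka.
have arcE s : 0 < s < l -> Defs.arc a w l (geod a w s) by move=> sl; exists s.
have l0 : 0 < l by rewrite (lt_trans t0)// (lt_trans tt').
have lpi : l <= pi.
  have [disj circ] := good.
  have [|||A [B [la [lb [Aarc Barc lapi lbpi AB]]]]] := circ (range (geod a w)).
  - by exists a, w.
  - by exists a; split => //; exists 0; rewrite // geod0.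
  - by exists (geod a w l); split => //; exists l.
  apply: (arc_length_le_pi I1s I2s disj aa aw l0 l2pi _ _ Aarc Barc lapi lbpi AB) => //.
  - by right.
  - by right.
exists (geod_velocity a w t), t, (l - t), (t' - t); split.
- split; first split.
  + exact: sphere_geod.
  + exact: unit_tangent_geod.
  + by [].
  + by rewrite subr_gt0 (lt_trans tt').
  + by rewrite addrC subrK.
  + by rewrite geod_shift subrr geod0.
  + by rewrite geod_shift addrC subrK.
  + move=> s /andP[s1 s2]; rewrite geod_shift; apply: arcO; apply: arcE.
    by apply/andP; split; lra.
  + move=> P /nsup; apply: contra_not => hP _ [s /= sl <-].
    move: sl; rewrite in_itv/= => /andP[s1 s2].
    have := hP (s - t); rewrite geod_shift [t + (s - t)]addrC subrK; apply.
    by apply/andP; split; lra.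
- by apply/andP; split; lra.
- by rewrite geod_shift addrC subrK.
Qed.

Lemma chord_prec x v b c s s' : chord x v b c -> - b < s -> s < s' -> s' < c ->
  prec I1 I2 (geod x v s) (geod x v s').
Proof.
move=> [[xx xv b0 c0 bc] K1 K2 O nsup] bs ss' s'c.
have sh t : geod (geod x v (- b)) (geod_velocity x v (- b)) t = geod x v (t - b).
  by rewrite geod_shift addrC.
exists (geod x v (- b)), (geod_velocity x v (- b)), (b + c), (s + b), (s' + b).
have pi0 := pi_gt0 R; split; split.
- by [].
- exact: unit_tangent_geod.
- by rewrite mulr2n; lra.
- by rewrite sh addrAC subrr add0r.
- move=> _ [t /= + <-]; rewrite in_itv/= sh => /andP[t1 t2].
  by apply: O; apply/andP; split; lra.
- move=> P /nsup; apply: contra_not => hP t /andP[t1 t2].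
  apply: hP; exists (t + b); last by rewrite sh addrK.
  by rewrite /= in_itv/=; apply/andP; split; lra.
- by split; lra.
- by rewrite sh addrK.
- by rewrite sh addrK.
Qed.

Lemma chord_shift x v b c s : chord x v b c -> - b < s < c ->
  chord (geod x v s) (geod_velocity x v s) (b + s) (c - s).
Proof.
move=> [[xx xv b0 c0 bc] K1 K2 O nsup] /andP[bs sc].
split; first split.
- exact: sphere_geod.
- exact: unit_tangent_geod.
- by lra.
- by lra.
- by lra.
- rewrite geod_shift opprD addrCA subrr addr0; exact: K1.
- rewrite geod_shift addrCA subrr addr0; exact: K2.
- by move=> t /andP[t1 t2]; rewrite geod_shift; apply: O; apply/andP; split; lra.
- move=> P /nsup; apply: contra_not => hP t /andP[t1 t2].
  have := hP (t - s); rewrite geod_shift [s + (t - s)]addrC subrK; apply.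
  by apply/andP; split; lra.
Qed.

(** Along a great circle a linear form vanishing at parameter c is k sin (c - s). [boundary_support]
    gives k >= 0, and k = 0 would put the chord in a supporting hypersphere. *)
Lemma chord_support x v b c : chord x v b c ->
  exists u k, [/\ supports I2 u, 0 < k &
    forall s, dot (geod x v s) u = k * sin (c - s)].
Proof.
move=> [[xx xv b0 c0 bc] K1 K2 O nsup].
have sh t : geod (geod x v c) (geod_velocity x v c) t = geod x v (c + t).
  by rewrite geod_shift.
have [|u [su au vu]] := boundary_support I2_neq0 I2_open I2_convex K2
    (unit_tangent_geod c xx xv).
  (* The minimum with c keeps the point on the open chord, hence outside [I2]. *)
  move=> e e0; exists (Num.min e c / 2).
    have m0 : 0 < Num.min e c by rewrite lt_min e0 c0.
    have me : Num.min e c <= e by rewrite ge_min lexx.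
    by apply/andP; split; lra.
  rewrite sh => I2x.
  have [_ []] : Omega I1 I2 (geod x v (c - Num.min e c / 2)).
    have m0 : 0 < Num.min e c by rewrite lt_min e0 c0.
    have me : Num.min e c <= c by rewrite ge_min lexx orbT.
    by apply: O; apply/andP; split; lra.
  by right; left.
have dotE' s : dot (geod x v s) u = - dot (geod_velocity x v c) u * sin (c - s).
  have -> : geod x v s = geod x v (c + - (c - s)) by rewrite opprB addrC subrK.
  by rewrite -sh dot_geod au sinN mulr0 add0r mulNr mulrC mulNr.
exists u, (- dot (geod_velocity x v c) u); split => //.
rewrite oppr_gt0 lt_neqAle vu andbT; apply/eqP => v0.
apply: (nsup (hypersphere u)); first by right; exact: supporting_hypersphere.
move=> s _; split; first exact: sphere_geod.
by rewrite dotE' v0 oppr0 mul0r.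
Qed.

Lemma supports_closure u y : supports I2 u -> closure I2 y -> dot y u <= 0.
Proof.
move=> [_ I2u _] cly.
have cl : closed [set z : E | dot z u <= 0].
  have -> : [set z : E | dot z u <= 0] = (fun z => dot z u) @^-1` [set r | r <= 0] by [].
  by apply: preimage_closed; [move=> z _; exact: continuous_dotl|exact: closed_le].
by apply: (cl y); apply: closureS cly => z /I2u /ltW.
Qed.

(** The chord ends in the closure of [I2], so cos c <x, u> + sin c <v, u> <= 0; divide by sin c >
    0. *)
Lemma chord_slope x v b c u : chord x v b c -> supports I2 u ->
  dot v u <= - (cos c / sin c) * dot x u.
Proof.
move=> [[xx xv b0 c0 bc] K1 [K2 _] O nsup] su.
have sc : 0 < sin c by apply: sin_gt0_pi; apply/andP; split; lra.
have := supports_closure su K2; rewrite dot_geod => h.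
rewrite -(ler_pM2l sc).
have -> : sin c * (- (cos c / sin c) * dot x u) = - (cos c * dot x u).
  by field; rewrite gt_eqF.
by rewrite -subr_ge0; lra.
Qed.

Lemma cone_tangent x v : cone I1 I2 x v -> tangent x v.
Proof. by case=> [->|[]//]; rewrite /tangent/= dot0r. Qed.

Lemma enormZ b x : 0 <= b -> enorm (b *: x) = b * enorm x.
Proof. by move=> b0; rewrite /enorm !dotE mulrA -expr2 sqrtrM ?sqr_ge0// sqrtr_sqr ger0_norm. Qed.

Lemma sexp_unit x w b : unit_tangent x w -> 0 < b -> sexp x (b *: w) = geod x w b.
Proof.
move=> [_ ww] b0; rewrite /sexp enormZ ?ltW// /enorm ww sqrtr1 mulr1 scalerA.
by rewrite mulVf ?gt_eqF// scale1r.
Qed.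

Lemma unit_tangent_normalize x v : tangent x v -> v <> 0 ->
  unit_tangent x ((enorm v)^-1 *: v).
Proof.
by move=> xv v0; split; [rewrite /tangent/= dotZr xv mulr0|exact: dot_normalize].
Qed.

Lemma geod_direction_inj x w w' r r' : sphere x -> unit_tangent x w ->
  unit_tangent x w' -> 0 < r < pi -> 0 < r' < pi -> geod x w r = geod x w' r' ->
  w = w'.
Proof.
move=> xx [xw ww] [xw' ww'] rpi r'pi e.
have itv t : 0 < t < pi -> t \in `[0, pi]%R.
  by move=> /andP[t0 tp]; rewrite in_itv/= !ltW.
have rr' : r = r'.
  apply: cos_inj; rewrite ?itv//.
  have := congr1 (fun z => dot z x) e; rewrite !dot_geod !(dotC _ x).
  by rewrite xw xw' xx !mulr0 !addr0 !mulr1.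
move: e; rewrite -rr' /geod => /addrI /scalerI; apply.
by rewrite gt_eqF// sin_gt0_pi.
Qed.

(** A point reached before arc length pi determines its initial direction, so the chord through the
    future point does leave x along v. *)
Lemma cone_chord x v : sphere x -> cone I1 I2 x v -> v <> 0 ->
  exists b c, chord x ((enorm v)^-1 *: v) b c.
Proof.
move=> xx [//|[xv v0 [t [t0 tpi [_ xy]]]] _]; move: xy.
have e0 := enorm_gt0 v0.
have ut := unit_tangent_normalize xv v0.
have -> : t *: v = (t * enorm v) *: ((enorm v)^-1 *: v).
  by rewrite scalerA mulfK ?gt_eqF.
rewrite sexp_unit ?mulr_gt0// => /prec_chord [w [b [c [r [ch /andP[r0 rc] e]]]]].
have [[_ xw b0 c0 bc] _ _ _ _] := ch.
exists b, c; rewrite (geod_direction_inj xx ut xw _ _ e)//.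
- by rewrite mulr_gt0.
- by apply/andP; split; lra.
Qed.

Lemma chord_cone x w b c e : chord x w b c -> 0 < e -> cone I1 I2 x (e *: w).
Proof.
move=> ch e0; right; have [[xx xw b0 c0 bc] _ _ O _] := ch.
have w0 : w <> 0.
  by move=> w0; have [_ /eqP] := xw; rewrite w0 dot0l eq_sym oner_eq0.
split.
- by have [xw0 _] := xw; rewrite /tangent/= dotZr xw0 mulr0.
- by move=> /eqP; rewrite scaler_eq0 gt_eqF//= => /eqP.
(* At this time the exponential has travelled c / 2, strictly inside the chord. *)
- exists (c / 2 / e); rewrite enormZ ?ltW//.
  have [_ ww] := xw; rewrite {1}/enorm ww sqrtr1 mulr1 divfK ?gt_eqF//.
  split; [by rewrite !divr_gt0|by lra|].
  rewrite scalerA divfK ?gt_eqF// sexp_unit//; last by lra.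
  split; first by apply: O; apply/andP; split; lra.
  by rewrite -{1}(geod0 x w); apply: (chord_prec ch); lra.
Qed.

Lemma funk_chord x v b c r : chord x v b c -> 0 < r < c ->
  funk I2 x (geod x v r) = ln (sin c / sin (c - r)).
Proof.
move=> [[xx xv b0 c0 bc] K1 K2 O nsup] /andP[r0 rc].
have [xv0 vv] := xv.
have rpi : r < pi by lra.
have cpi : c < pi by lra.
have sr : 0 < sin r by apply: sin_gt0_pi; rewrite r0.
have xy : dot x (geod x v r) = cos r by rewrite -{1}(geod0 x v) dot_geod_geod// sub0r cosN.
have cr1 : cos r < 1 by rewrite -cos0 ltr_cos// in_itv/= ?lexx ?pi_ge0// !ltW.
rewrite /funk ifF; last first.
  by apply/eqP => e; move: cr1; rewrite -xy -e xx ltxx.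
have tE : toward x (geod x v r) = v.
  rewrite /toward xy [geod x v r - _](_ : _ = sin r *: v); last first.
    by rewrite /geod addrAC subrr add0r.
  rewrite enormZ ?ltW// {1}/enorm vv sqrtr1 mulr1 scalerA mulVf ?gt_eqF//.
  by rewrite scale1r.
have -> : first_hit (sboundary I2) x (geod x v r) = geod x v c.
  rewrite /first_hit tE; congr (geod x v); set S := [set _ | _].
  have Sc : S c by [].
  have lbS : lbound S c.
    move=> t [t0 Kt]; rewrite leNgt; apply/negP => tc.
    have [_ []] : Omega I1 I2 (geod x v t) by apply: O; apply/andP; split; lra.
    by right; right.
  apply/eqP; rewrite eq_le; apply/andP; split.
    by apply: ge_inf => //; exists c.
  by apply: lb_le_inf => //; exists c.
have -> : dist x (geod x v c) = c.
  by rewrite /dist -{1}(geod0 x v) dot_geod_geod// sub0r cosN cosK// in_itv/= !ltW.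
have -> : dist (geod x v r) (geod x v c) = c - r.
  rewrite /dist dot_geod_geod// -cosN opprB cosK// in_itv/=.
  by apply/andP; split; lra.
by [].
Qed.

Lemma funk_functional_le x v u : sphere x -> tangent x v -> supports I2 u ->
  0 < dot x u -> (funk_functional I2 x v <= (- dot v u / dot x u)%:E)%E.
Proof.
move=> xx xv su xu; rewrite /funk_functional.
have [->|v0] := eqVneq v 0; first by rewrite dot0l oppr0 mul0r.
by apply: ereal_inf_lbound; apply/funk_quotientsP => //; exists u.
Qed.

Lemma funk_functional_chord_ge x w b c e : chord x w b c -> 0 < e ->
  ((e * (cos c / sin c))%:E <= funk_functional I2 x (e *: w))%E.
Proof.
move=> ch e0; have [[xx xw b0 c0 bc] _ _ _ _] := ch.
have [xw0 ww] := xw.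
have w0 : w <> 0 by move=> w0; move: ww; rewrite w0 dot0l => /eqP; rewrite eq_sym oner_eq0.
rewrite /funk_functional ifF; last first.
  by rewrite scaler_eq0 gt_eqF//=; apply/eqP.
apply: le_ereal_inf_tmp => r.
have xew : tangent x (e *: w) by rewrite /tangent/= dotZr xw0 mulr0.
move=> /(funk_quotientsP _ I2s I2_neq0 xx xew) [u [su xu ->]].
rewrite lee_fin ler_pdivlMr// dotZl -mulrN -mulrA ler_pM2l//.
by have := chord_slope ch su; rewrite mulNr lerNr.
Qed.

(** By [chord_slope] it is enough that - cot c <= 1 / e. Since c <= pi - b, - cos c <= cos b <= 1 -
    e, the last step because the chord starts on K1. *)
Lemma cone_velocity_le x v u e : sphere x -> cone I1 I2 x v -> supports I2 u ->
  0 < dot x u -> 0 < e -> (forall a, sboundary I1 a -> dot a x <= 1 - e) ->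
  dot v u <= enorm v / e * dot x u.
Proof.
move=> xx cv su xu e0 far.
have [->|/eqP v0] := eqVneq v 0.
  by rewrite dot0l !mulr_ge0 ?enorm_ge0 ?invr_ge0 ?(ltW e0) ?ltW.
have ev := enorm_gt0 v0.
have [b [c ch]] := cone_chord xx cv v0.
have := chord_slope ch su; have [[_ xw b0 c0 bc] K1 _ _ _] := ch.
set w := _ *: v in ch xw K1 * => slope.
have vw : dot v u = enorm v * dot w u by rewrite dotZl mulVKf ?gt_eqF.
have cosb : - cos c <= 1 - e.
  have := far _ K1; rewrite -{2}(geod0 x w) dot_geod_geod// subr0 cosN.
  apply: le_trans; have -> : - cos c = cos (pi - c) by rewrite addrC cosDpi cosN.
  by rewrite leNgt ltr_cos ?in_itv/= -?leNgt; [lra|apply/andP; split; lra|apply/andP; split; lra].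
have sc : 0 < sin c by apply: sin_gt0_pi; apply/andP; split; lra.
rewrite vw -mulrA ler_pM2l//; apply: le_trans slope _.
rewrite ler_pM2r// -mulNr ler_pdivrMr// -(ler_pM2l e0) mulrCA mulrA mulVf ?gt_eqF// mul1r.
have := cos2Dsin2 c => cs.
have [c1|c1] := leP 0 (cos c).
  by apply: le_trans (ltW sc); rewrite mulrN oppr_le0 mulr_ge0// ltW.
have s1 : sin c <= 1 by exact: sin_le1.
have cN1 : -1 <= cos c by exact: cos_geN1.
(* Here e < 1, and sin^2 c >= 1 - (1 - e)^2 >= e^2. *)
have es : e <= sin c by nra.
by apply: le_trans es; rewrite ger_pMr//; lra.
Qed.

End Chord.

(** * One-sided derivatives and integrals *)

Section Integral.
Context d (T : measurableType d) (R : realType).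
Variables (mu : {measure set T -> \bar R}) (D : set T).
Local Open Scope ereal_scope.

(* Measurability of [f] and [g] is not assumed: the infimum defining the Funk
   functional is not known to be measurable along a curve. *)
Lemma le_integral_nonmeasurable (f g : T -> \bar R) :
  (forall x, D x -> f x <= g x) ->
  \int[mu]_(x in D) f x <= \int[mu]_(x in D) g x.
Proof.
(* For nonnegative functions the integral is a supremum over simple functions below, which is
   monotone as such; the general case splits into positive and negative parts. *)
have ge0_le (h k : T -> \bar R) : (forall x, D x -> 0 <= h x) ->
    (forall x, D x -> h x <= k x) ->
    \int[mu]_(x in D) h x <= \int[mu]_(x in D) k x.
  move=> h0 hk; have k0 x : D x -> 0 <= k x by move=> Dx; exact: le_trans (h0 _ Dx) (hk _ Dx).
  rewrite !ge0_integralE//; apply: ge_ereal_sup => _ /= [s hs <-].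
  apply: ereal_sup_ubound; exists s => //= x; apply: le_trans (hs x) _.
  by rewrite /patch; case: ifPn => // /set_mem /hk.
move=> fg; rewrite integralE [leRHS]integralE leeB//; apply: ge0_le => //= x Dx.
- by apply: (@funepos_le _ _ D f g) => [y /set_mem /fg//|]; exact: mem_set.
- by apply: (@funeneg_le _ _ D f g) => [y /set_mem /fg//|]; exact: mem_set.
Qed.

(** Nothing is known of f on [N], so g is raised to +oo there; the result is measurable, dominates f
    on all of [D], and has the same integral as g. *)
Lemma le_integral_off_null (N : set T) (f g : T -> \bar R) :
  measurable D -> measurable N -> mu N = 0 -> measurable_fun D g ->
  (forall x, D x -> ~ N x -> f x <= g x) ->
  \int[mu]_(x in D) f x <= \int[mu]_(x in D) g x.
Proof.
move=> mD mN N0 mg fg.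
pose G x := if x \in N then +oo else g x.
have mG : measurable_fun D G.
  rewrite -(setDUK (@subIsetl _ D N)); apply/measurable_funU.
  - exact: measurableI.
  - by apply: measurableD => //; exact: measurableI.
  split.
  - apply: (eq_measurable_fun (cst +oo)); last exact: measurable_cst.
    by move=> x /set_mem[_ Nx]; rewrite /G mem_set.
  - apply: (eq_measurable_fun g).
      move=> x /set_mem[Dx nx]; rewrite /G ifF//.
      by apply/negP => /set_mem Nx; apply: nx.
    by apply: measurable_funS mg => // x [].
apply: (@le_trans _ _ (\int[mu]_(x in D) G x)).
  apply: le_integral_nonmeasurable => x Dx; rewrite /G; case: ifPn => [_|nx].
    by rewrite leey.
  by apply: fg => // Nx; move: nx; rewrite mem_set.
rewrite le_eqVlt; apply/orP; left; apply/eqP; apply: ae_eq_integral => //.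
exists N; split => // x /= /not_implyP[Dx Gg]; apply: contrapT => Nx.
by apply: Gg; rewrite /G ifF//; apply/negP => /set_mem.
Qed.

End Integral.

Section OneSidedDerivative.
Context {R : realType} {n : nat}.
Local Notation E := 'rV[R]_n.+1.
Implicit Types (u v w : E) (s : R -> E) (a b t : R).

Lemma cvg_shift_right (f : R -> E) t (l : E) :
  f (t + h) @[h --> 0^'+] --> l -> f x @[x --> t^'+] --> l.
Proof.
move=> fl A Al; have [e /= e0 He] := fl A Al; exists e => //= x tx xt.
have := He (x - t); rewrite /= [t + (x - t)]addrC subrK; apply; last by rewrite subr_gt0.
by rewrite /ball/= sub0r normrN; move: tx; rewrite /ball/= distrC.
Qed.

Lemma cvg_shift_left (f : R -> E) t (l : E) :
  f (t + h) @[h --> 0^'-] --> l -> f x @[x --> t^'-] --> l.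
Proof.
move=> fl A Al; have [e /= e0 He] := fl A Al; exists e => //= x tx xt.
have := He (x - t); rewrite /= [t + (x - t)]addrC subrK; apply; last by rewrite subr_lt0.
by rewrite /ball/= sub0r normrN; move: tx; rewrite /ball/= distrC.
Qed.

Lemma cvg_of_quotient (F : set_system R) (FF : Filter F) s t v :
  h @[h --> F] --> (0 : R) -> (\forall h \near F, h != 0) ->
  h^-1 *: (s (t + h) - s t) @[h --> F] --> v -> s (t + h) @[h --> F] --> s t.
Proof.
move=> F0 Fn0 sv.
have hs : h *: (h^-1 *: (s (t + h) - s t)) + s t @[h --> F] --> 0 *: v + s t.
  by apply: cvgD; [exact: cvgZ|exact: cvg_cst].
rewrite scale0r add0r in hs; apply: cvg_trans hs; apply: near_eq_cvg.
near=> h; rewrite scalerA divff; last by near: h.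
by rewrite scale1r subrK.
Unshelve. all: by end_near. Qed.

Lemma right_cvg_0 : h @[h --> (0 : R)^'+] --> (0 : R).
Proof. by apply: cvg_at_right_filter; exact: cvg_id. Qed.

Lemma left_cvg_0 : h @[h --> (0 : R)^'-] --> (0 : R).
Proof. by apply: cvg_at_left_filter; exact: cvg_id. Qed.

Lemma is_rderiv_cvg s t v : is_rderiv s t v -> s x @[x --> t^'+] --> s t.
Proof.
move=> sv; apply: cvg_shift_right; apply: (cvg_of_quotient _ right_cvg_0 _ sv).
by near=> h; rewrite gt_eqF.
Unshelve. all: by end_near. Qed.

Lemma is_lderiv_cvg s t v : is_lderiv s t v -> s x @[x --> t^'-] --> s t.
Proof.
move=> sv; apply: cvg_shift_left; apply: (cvg_of_quotient _ left_cvg_0 _ sv).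
by near=> h; rewrite lt_eqF.
Unshelve. all: by end_near. Qed.

Lemma two_sided_is_derive s t v : is_rderiv s t v -> is_lderiv s t v ->
  is_derive t 1 s v.
Proof.
move=> sr sl; have h : h^-1 *: (s (h *: 1 + t) - s t) @[h --> 0^'] --> v.
  have -> : (fun h : R => h^-1 *: (s (h *: 1 + t) - s t)) =
            (fun h => h^-1 *: (s (t + h) - s t)).
    by apply/funext => h; rewrite [h%:A]mulr1 [t + h]addrC.
  move=> A Av; have [e1 /= e10 h1] := sr A Av; have [e2 /= e20 h2] := sl A Av.
  exists (Num.min e1 e2); first by rewrite /= lt_min e10.
  move=> h; rewrite /ball_/= lt_min => /andP[he1 he2]; rewrite neq_lt => /orP[h0|h0].
  - exact: h2.
  - exact: h1.
apply: DeriveDef; first by apply/cvg_ex; exists v.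
by apply: cvg_lim h.
Qed.

Lemma is_derive_dot s t v u : is_derive t 1 s v ->
  is_derive t 1 (fun x => dot (s x) u) (dot v u).
Proof.
move=> [/cvg_ex[l sl] sv].
have {}sv : l = v by rewrite -sv; apply/esym; exact: cvg_lim sl.
have h : h^-1 *: ((dot (s (h *: 1 + t)) u : R) - dot (s t) u) @[h --> 0^'] --> dot v u.
  have -> : (fun h : R => h^-1 *: ((dot (s (h *: 1 + t)) u : R) - dot (s t) u)) =
            (fun h => dot (h^-1 *: (s (h *: 1 + t) - s t)) u).
    by apply/funext => h; rewrite !dotE.
  by rewrite -sv; apply: cvg_dot => //; exact: cvg_cst.
apply: DeriveDef; first by apply/cvg_ex; exists (dot v u).
by apply: cvg_lim h.
Qed.

Lemma C1_on_continuous s a b : a < b -> C1_on s a b -> {within `[a, b], continuous s}.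
Proof.
move=> ab [g [_ sr sl]]; apply/(continuous_within_itvP _ ab); split.
- move=> t; rewrite in_itv/= => /andP[at_ tb].
  have [sd _] : is_derive t 1 s (g t).
    by apply: two_sided_is_derive; [apply: sr|apply: sl]; rewrite ?at_ ?tb ?ltW.
  by apply: differentiable_continuous; exact/derivable1_diffP.
- by apply: is_rderiv_cvg (sr a _); rewrite lexx.
- by apply: is_lderiv_cvg (sl b _); rewrite ab lexx.
Qed.

Lemma within_dot (A : set R) (f : R -> E) u : {within A, continuous f} ->
  {within A, continuous (fun t => dot (f t) u)}.
Proof. by move=> cf t; exact: (cvg_dot _ (cf t) (cvg_cst u)). Qed.

End OneSidedDerivative.

Section LogIntegral.
Context {R : realType} {n : nat}.
Local Notation E := 'rV[R]_n.+1.
Implicit Types (s : R -> E) (a b t : R).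
Variable u : E.
Local Notation mu := (@lebesgue_measure R).

(** The integrand uses the continuous field g of one-sided derivatives, which reaches the ends of
    the piece, where [derive1] may fail to be the derivative; its primitive is - ln <s, u>. *)
Lemma integral_ln_piece s a b : a < b -> C1_on s a b ->
  (forall t, a <= t <= b -> 0 < dot (s t) u) ->
  exists f : R -> R, [/\ measurable_fun `[a, b] f,
    forall t, a < t < b -> derivable s t 1 /\ f t = - dot (derive1 s t) u / dot (s t) u &
    (\int[mu]_(t in `[a, b]) (f t)%:E =
     (ln (dot (s a) u) - ln (dot (s b) u))%:E)%E].
Proof.
move=> ab C1 pos; have cs := C1_on_continuous ab C1; move: C1 => [g [cg sr sl]].
have sd t : a < t < b -> is_derive t 1 s (g t).
  move=> /andP[at_ tb].
  by apply: two_sided_is_derive; [apply: sr|apply: sl]; rewrite ?at_ ?tb ?ltW.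
pose f t := - dot (g t) u / dot (s t) u.
have cf : {within `[a, b], continuous f}.
  apply/subspace_continuousP => t /= tab.
  have cgt := (subspace_continuousP _ _).1 (@within_dot R n _ _ u cg) t tab.
  have cst := (subspace_continuousP _ _).1 (@within_dot R n _ _ u cs) t tab.
  apply: cvgM; first exact: cvgN.
  by apply: cvgV => //; rewrite gt_eqF// pos//; move: tab; rewrite in_itv.
exists f; split.
- by apply: subspace_continuous_measurable_fun.
- by move=> t /sd [sd1 sd2]; split => //; rewrite /f derive1E sd2.
pose F t := - ln (dot (s t) u).
have cF : {within `[a, b], continuous F}.
  apply/subspace_continuousP => t /= tab; apply: cvgN.
  have cst := (subspace_continuousP _ _).1 (@within_dot R n _ _ u cs) t tab.
  apply: (cvg_comp _ _ cst); apply: continuous_ln; apply: pos.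
  by move: tab; rewrite in_itv.
have /(continuous_within_itvP _ ab)[_ cFa cFb] := cF.
have Fd t : a < t < b -> is_derive t 1 F (f t).
  move=> tab; have := is_derive_dot u (sd _ tab) => gd.
  have gt0 : 0 < dot (s t) u by apply: pos; move: tab => /andP[? ?]; rewrite !ltW.
  have lnd := is_derive1_ln gt0.
  have -> : f t = - ((dot (s t) u)^-1 * dot (g t) u) by rewrite /f mulNr mulrC.
  exact: is_deriveN (is_derive1_comp lnd gd).
rewrite (@continuous_FTC2 _ f F)//.
- by rewrite /F -EFinB opprK addrC.
- split => // t; rewrite in_itv/= => /Fd []//.
- by move=> t; rewrite in_itv/= => /Fd [_ <-]; rewrite derive1E.
Qed.

End LogIntegral.

(** * Timelike curves *)

Section Curve.
Context {R : realType} {n : nat}.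
Local Notation E := 'rV[R]_n.+1.
Variables I1 I2 : set E.
Hypotheses (I1s : I1 `<=` sphere) (I2_neq0 : I2 !=set0) (I2_open : sopen I2).
Hypotheses (I2_convex : sconvex I2) (good : good_position I1 I2).
Implicit Types (x y z u v w : E) (s : R -> E) (a b c e r t : R).
Local Notation mu := (@lebesgue_measure R).

Let I2s : I2 `<=` sphere.
Proof. by have [] := I2_convex. Qed.

Lemma Omega_sphere x : Omega I1 I2 x -> sphere x. Proof. by case. Qed.

(** K1 is closed and misses x0. For unit vectors |a - x|^2 = 2 - 2 <a, x>, so staying r / 2 away
    from K1 gives e = (r / 2)^2 / 2. *)
Lemma boundary_gap x0 : Omega I1 I2 x0 -> exists e r, [/\ 0 < e, 0 < r &
  forall x (a : E), sphere x -> `|x0 - x| < r -> sboundary I1 a -> dot a x <= 1 - e].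
Proof.
move=> [xx0 nx0].
have : nbhs x0 (~` sboundary I1).
  apply: open_nbhs_nbhs; split; first exact/closed_openC/closed_sboundary.
  by move=> Kx; apply: nx0; left; right.
move=> /nbhs_ballP[r /= r0 far].
have r20 : 0 < r / 2 by rewrite divr_gt0.
exists ((r / 2) ^+ 2 / 2), (r / 2); split => //.
  by rewrite divr_gt0// exprn_gt0.
move=> x a xx x0x Ka.
have aa : sphere a := sboundary_sphere I1s Ka.
have ax : r / 2 <= enorm (a - x).
  apply: le_trans (mxnorm_le_enorm _); rewrite leNgt; apply/negP => ax.
  apply: (far a) => //; rewrite -ball_normE/=.
  rewrite -(subrKA x) (le_lt_trans (ler_normD _ _))// (splitr r) ltrD//.
  by rewrite distrC.
have : (r / 2) ^+ 2 <= dot (a - x) (a - x).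
  by rewrite -sqr_enorm ler_sqr// nnegrE ?enorm_ge0// ltW.
rewrite !dotE aa xx (dotC x a); lra.
Qed.

(* Just after the last time [t1] at which [g = dot (s _) u] is nonpositive,
   [g' <= M g]; the maximum [G] of [g] on a short interval [t1, t2] then satisfies
   [G <= M * G * (t2 - t1) < G]. *)
Lemma piece_positive s a b u t t0 : a < b -> C1_on s a b ->
  (forall t, a <= t <= b -> Omega I1 I2 (s t)) ->
  (forall t v, a < t < b -> is_rderiv s t v -> cone I1 I2 (s t) v) ->
  supports I2 u -> a <= t -> t <= t0 -> t0 <= b ->
  0 < dot (s t0) u -> 0 < dot (s t) u.
Proof.
move=> ab C1 O cn su at_ tt0 t0b g0; rewrite ltNge; apply/negP => gt.
have cs := C1_on_continuous ab C1.
have cg := @within_dot R n _ _ u cs.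
have [ds [cds sr sl]] := C1.
pose g (x : R) := dot (s x) u.
pose S := [set x : R | t <= x <= t0 /\ g x <= 0].
have St : S t by rewrite /S/= lexx tt0.
have ubS : ubound S t0 by move=> x [/andP[]].
have supS : has_sup S by split; [exists t|exists t0].
set t1 := sup S.
have tt1 : t <= t1 by apply: ub_le_sup => //; exists t0.
have t1t0 : t1 <= t0 by apply: ge_sup => //; exists t.
have t1ab : a <= t1 <= b by rewrite (le_trans at_ tt1) (le_trans t1t0 t0b).
have t1in : t1 \in `[a, b] by rewrite in_itv.
have gt1 : g t1 <= 0.
  rewrite leNgt; apply/negP => gt1.
  have cgt1 := (subspace_continuousP _ _).1 cg t1 t1in.
  have [d /= d0 Hd] := cvgr_gt _ cgt1 _ gt1.
  have [x Sx xt1] := sup_adherent d0 supS.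
  have xle : x <= t1 by apply: ub_le_sup => //; exists t0.
  have [/andP[tx xt0] gx] := Sx.
  have : 0 < g x.
    apply: Hd; last by rewrite /= in_itv/= (le_trans at_ tx) (le_trans xt0 t0b).
    rewrite /ball_/= ger0_norm ?subr_ge0//.
    by move: xt1; rewrite -/t1 => xt1; lra.
  by rewrite ltNge gx.
have gpos (x : R) : t1 < x -> x <= t0 -> 0 < g x.
  move=> t1x xt0; rewrite ltNge; apply/negP => gx.
  have : x <= t1 by apply: ub_le_sup; [exists t0|rewrite /S/= xt0 (le_trans tt1 (ltW t1x))].
  by rewrite leNgt t1x.
have t1t0' : t1 < t0.
  rewrite lt_neqAle t1t0 andbT; apply/eqP => e.
  by move: gt1; rewrite e leNgt; move: g0 => ->.
have [e [r [e0 r0 gap]]] := boundary_gap (O _ t1ab).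
have cst1 := (subspace_continuousP _ _).1 cs t1 t1in.
have /cvgrPdist_lt /(_ _ r0) [d /= d0 Hd] := cst1.
have cen : {within `[a, b], continuous (fun x : R => enorm (ds x))}.
  move=> x; apply: (continuous_comp (cds x)); exact: continuous_enorm.
have [m min_ hm] := EVT_max (ltW ab) cen.
set B := enorm (ds m) in hm.
have B0 : 0 <= B by exact: enorm_ge0.
(* [B] is the maximal speed on the piece, so [M] bounds the coefficient in [cone_velocity_le]. *)
pose M := B / e.
have M0 : 0 <= M by rewrite divr_ge0// ltW.
(* The bound t0 keeps g positive after t1, d / 2 keeps the curve where [gap] applies, and 1 / (M +
   1) gives M (t2 - t1) < 1. *)
pose t2 := Num.min t0 (t1 + Num.min (d / 2) (M + 1)^-1).
have M10 : 0 < (M + 1)^-1 by rewrite invr_gt0; lra.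
have t12 : t1 < t2.
  by rewrite lt_min t1t0' ltrDl lt_min divr_gt0.
have t20 : t2 <= t0 by rewrite ge_min lexx.
have t2d : t2 - t1 < d.
  have : t2 <= t1 + d / 2 by rewrite ge_min lerD2l ge_min lexx orbT.
  by lra.
have t2M : M * (t2 - t1) < 1.
  have : t2 <= t1 + (M + 1)^-1 by rewrite ge_min lerD2l ge_min lexx !orbT.
  move=> h; have {}h : t2 - t1 <= (M + 1)^-1 by lra.
  apply: (@le_lt_trans _ _ (M * (M + 1)^-1)); first exact: ler_wpM2l.
  by rewrite ltr_pdivrMr; lra.
have sub12 : `[t1, t2] `<=` `[a, b].
  move=> x /=; rewrite !in_itv/= => /andP[h1 h2]; move: t1ab => /andP[h3 _].
  by rewrite (le_trans h3 h1) (le_trans h2) ?(le_trans t20).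
have cg12 : {within `[t1, t2], continuous g} by exact: continuous_subspaceW cg.
have [c] := EVT_max (ltW t12) cg12; rewrite in_itv/= => /andP[t1c ct2] hc.
have gc : 0 < g c.
  apply: (@lt_le_trans _ _ (g t2)); first exact: gpos.
  by apply: hc; rewrite in_itv/= lexx ltW.
have {}t1c : t1 < c.
  rewrite lt_neqAle t1c andbT; apply/eqP => e1.
  by move: gc; rewrite -e1 ltNge gt1.
have [h3 h4] := andP t1ab.
have cb : c <= b := le_trans ct2 (le_trans t20 t0b).
have gd (x : R) : x \in `]t1, c[%R -> is_derive x 1 g (dot (ds x) u).
  rewrite in_itv/= => /andP[h1 h2].
  have hx1 := le_lt_trans h3 h1; have hx2 := lt_le_trans h2 cb.
  by apply: is_derive_dot; apply: two_sided_is_derive; [apply: sr|apply: sl];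
    rewrite ?hx1 ?hx2 ?ltW.
have cgc : {within `[t1, c], continuous g}.
  apply: continuous_subspaceW cg12 => x /=; rewrite !in_itv/= => /andP[-> h].
  exact: le_trans h ct2.
have [x] := MVT t1c gd cgc; rewrite in_itv/= => /andP[t1x xc] gE.
have xab : a < x < b by rewrite (le_lt_trans h3 t1x) (lt_le_trans xc cb).
have xab' : a <= x <= b by case/andP: xab => /ltW -> /ltW ->.
have xx := Omega_sphere (O _ xab').
have x0 : 0 < g x by apply: gpos => //; rewrite (le_trans (ltW xc)) ?(le_trans ct2).
have slope : dot (ds x) u <= enorm (ds x) / e * g x.
  apply: (cone_velocity_le I1s I2_convex good) => //.
    by apply: cn => //; apply: sr; case/andP: xab => /ltW -> ->.
  move=> a' Ka'; apply: gap => //; apply: Hd; last by rewrite /= in_itv.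
  rewrite /ball_/= distrC ger0_norm ?subr_ge0 ?ltW//.
  by apply: le_lt_trans t2d; rewrite lerD2r (le_trans (ltW xc)).
have gxc : g x <= g c by apply: hc; rewrite in_itv/= (ltW t1x) (le_trans (ltW xc)).
have eM : enorm (ds x) / e <= M.
  by rewrite ler_pM2r ?invr_gt0//; apply: hm; rewrite in_itv.
have slope' : dot (ds x) u <= M * g c.
  apply: (le_trans slope); apply: ler_pM => //; last exact: ltW.
  by rewrite divr_ge0 ?enorm_ge0// ltW.
have : g c <= M * g c * (c - t1).
  apply: (@le_trans _ _ (g c - g t1)); first by rewrite lerDl oppr_ge0.
  by rewrite gE ler_wpM2r// subr_ge0 ltW.
have : M * g c * (c - t1) < g c.
  rewrite mulrAC -[ltRHS]mul1r ltr_pM2r//; apply: le_lt_trans t2M.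
  by rewrite ler_wpM2l// lerD2r.
by move=> h1 h2; have := lt_le_trans h1 h2; rewrite ltxx.
Qed.

Lemma is_derive_sides s t v : is_derive t 1 s v -> is_rderiv s t v /\ is_lderiv s t v.
Proof.
move=> [/cvg_ex[l sl] sv].
have {}sv : l = v by rewrite -sv; apply/esym; exact: cvg_lim sl.
have {}sl : h^-1 *: (s (t + h) - s t) @[h --> 0^'] --> v.
  rewrite -sv; have <- : (fun h : R => h^-1 *: (s (h *: 1 + t) - s t)) =
            (fun h => h^-1 *: (s (t + h) - s t)).
    by apply/funext => h; rewrite [h%:A]mulr1 [t + h]addrC.
  exact: sl.
split=> A /sl [e /= e0 He]; exists e => //= h he h0; apply: He => //.
- by rewrite gt_eqF.
- by rewrite lt_eqF.
Qed.

Section Pieces.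
Variables (s : R -> E) (k : nat) (b : nat -> R).
Hypotheses (b0 : b 0%N = 0) (b1 : b k = 1).
Hypothesis pieces : forall i, (i < k)%N -> b i < b i.+1 /\ C1_on s (b i) (b i.+1).

Lemma break_le i j : (i <= j)%N -> (j <= k)%N -> b i <= b j.
Proof.
elim: j => [|j IH]; first by rewrite leqn0 => /eqP->.
rewrite leq_eqVlt => /predU1P[->//|ij] jk.
apply: le_trans (IH ij (ltnW jk)) _.
by have [/ltW] := pieces jk.
Qed.

Definition breaks : set R := [set b i | i in `I_k.+1].

Lemma not_break t i : ~ breaks t -> (i <= k)%N -> t != b i.
Proof. by move=> nt ik; apply/eqP => ti; apply: nt; exists i => //=. Qed.

Lemma derivable_off_breaks t : 0 <= t <= 1 -> ~ breaks t -> derivable s t 1.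
Proof.
move=> /andP[t0 t1] nt.
have : forall i, (i <= k)%N -> t <= b i -> derivable s t 1.
  elim=> [|i IH] ik; first by move=> tb; move: (not_break nt ik); rewrite eq_le tb b0 t0.
  move=> tb; have [tbi|bit] := leP t (b i); first exact: IH (ltnW ik) tbi.
  have [ab [g [_ sr sl]]] := pieces ik.
  have tbi : t < b i.+1 by rewrite lt_neqAle not_break.
  have [] // : is_derive t 1 s (g t).
  by apply: two_sided_is_derive; [apply: sr|apply: sl]; rewrite ?tbi ?bit ?ltW.
by move=> /(_ k (leqnn k)); apply; rewrite b1.
Qed.

Lemma breaks_null : measurable breaks /\ mu breaks = 0%E.
Proof.
have fb : finite_set breaks by apply: finite_image; exact: finite_II.
split; last by apply: countable_lebesgue_measure0; exact: finite_set_countable.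
by apply: countable_measurable; [exact: measurable_set1|exact: finite_set_countable].
Qed.

Lemma integral_ln_pieces u : (forall t, 0 <= t <= 1 -> 0 < dot (s t) u) ->
  exists f : R -> R, [/\ measurable_fun `[(0 : R), 1] f,
    forall t, 0 <= t <= 1 -> ~ breaks t -> f t = - dot (derive1 s t) u / dot (s t) u &
    (\int[mu]_(t in `[0%R, 1%R]) (f t)%:E =
     (ln (dot (s 0) u) - ln (dot (s 1) u))%:E)%E].
Proof.
move=> pos.
have step i : (i <= k)%N -> exists f : R -> R, [/\ measurable_fun `[(0 : R), b i] f,
    forall t, 0 <= t <= b i -> ~ breaks t -> f t = - dot (derive1 s t) u / dot (s t) u &
    (\int[mu]_(t in `[0%R, b i]) (f t)%:E =
     (ln (dot (s 0) u) - ln (dot (s (b i)) u))%:E)%E].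
  elim: i => [_|i IH ik].
    exists (fun=> 0); split; first exact: measurable_cst.
    (* The interval is the single point 0, itself a break point, so the formula for f is vacuous. *)
    - move=> t; rewrite b0 => t0 nt; have := not_break nt (leq0n k).
      by rewrite b0 eq_le andbC t0.
    - by rewrite b0 set_itv1 integral_set1 subrr.
  have [f [mf fE If]] := IH (ltnW ik).
  have [ab C1] := pieces ik.
  have bi0 : 0 <= b i by rewrite -b0 break_le// ltnW.
  have bi1 : b i.+1 <= 1 by rewrite -b1 break_le.
  have [|h [mh hE Ih]] := @integral_ln_piece R n u s _ _ ab C1.
    by move=> t /andP[h1 h2]; apply: pos; rewrite (le_trans bi0 h1) (le_trans h2 bi1).
  pose F t := if t < b i then f t else h t.
  have UE : `[0, b i.+1]%classic = `[0, b i[%classic `|` `[b i, b i.+1]%classic :> set R.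
    by rewrite -itv_bndbnd_setU// bnd_simp// ltW.
  have Fl : {in `[0, b i[%classic, f =1 F}.
    by move=> t; rewrite inE/= in_itv/= => /andP[_ tb]; rewrite /F tb.
  have Fr : {in `[b i, b i.+1]%classic, h =1 F}.
    by move=> t; rewrite inE/= in_itv/= => /andP[tb _]; rewrite /F ltNge tb.
  have mf' : measurable_fun `[0, b i[%classic f.
    by apply: (measurable_funS _ _ mf) => //; apply: subset_itvl; rewrite bnd_simp.
  have mF : measurable_fun `[0, b i.+1]%classic F.
    rewrite UE; apply/measurable_funU => //; split.
    - exact: eq_measurable_fun Fl mf'.
    - exact: eq_measurable_fun Fr mh.
  exists F; split => //.
    move=> t /andP[t0 tb] nt; rewrite /F; have := not_break nt (ltnW ik).
    rewrite neq_lt => /orP[tbi|tbi]; first by rewrite tbi fE// t0 ltW.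
    rewrite ltNge (ltW tbi)/=; apply: (hE _ _).2; rewrite tbi/=.
    by rewrite lt_neqAle tb not_break.
  rewrite UE integral_setU//=; [|by rewrite -UE; exact/measurable_EFinP|].
    have -> : (\int[mu]_(x in `[0%R, b i[) (F x)%:E = \int[mu]_(x in `[0%R, b i[) (f x)%:E)%E.
      by apply: eq_integral => x /Fl ->.
    have -> : (\int[mu]_(x in `[b i, b i.+1]) (F x)%:E = \int[mu]_(x in `[b i, b i.+1]) (h x)%:E)%E.
      by apply: eq_integral => x /Fr ->.
    rewrite integral_itv_bndo_bndc; last exact/measurable_EFinP.
    by rewrite If Ih -EFinD; congr EFin; ring.
  apply/disj_setPS => x [] /=; rewrite !in_itv/= => /andP[_ h1] /andP[h2 _].
  by move: h1; rewrite ltNge h2.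
by have := step k (leqnn k); rewrite b1.
Qed.

Hypothesis sO : forall t, 0 <= t <= 1 -> Omega I1 I2 (s t).
Hypothesis s_timelike : timelike I1 I2 s.

(** [piece_positive] carries positivity back to the start of the piece containing t0, and induction
    carries it through the earlier pieces. *)
Lemma timelike_positive u t t0 : supports I2 u -> 0 <= t -> t <= t0 -> t0 <= 1 ->
  0 < dot (s t0) u -> 0 < dot (s t) u.
Proof.
move=> su t_ge0 + t01.
have : forall i, (i <= k)%N -> forall t0, t <= t0 -> t0 <= b i ->
    0 < dot (s t0) u -> 0 < dot (s t) u.
  elim=> [_ r|i IH ik r tr rb].
    by rewrite b0 => tr r0; have -> : t = r by apply/eqP; rewrite eq_le tr (le_trans r0).
  have [rbi|bir] := leP r (b i); first exact: (IH (ltnW ik) r).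
  have [ab C1] := pieces ik.
  have bi0 : 0 <= b i by rewrite -b0 break_le// ltnW.
  have bi1 : b i.+1 <= 1 by rewrite -b1 break_le.
  have pp (x : R) : b i <= x -> x <= r -> 0 < dot (s r) u -> 0 < dot (s x) u.
    move=> bx xr; apply: (piece_positive ab C1) => //.
    - by move=> y /andP[h1 h2]; apply: sO; rewrite (le_trans bi0 h1) (le_trans h2 bi1).
    - move=> y v /andP[h1 h2] yv; apply: s_timelike; left; split => //.
      by rewrite (le_trans bi0 (ltW h1)) (lt_le_trans h2 bi1).
  have [bt|tb] := leP (b i) t; first exact: pp.
  move=> rpos; apply: (IH (ltnW ik) (b i)) => //; first exact: ltW.
  by apply: pp => //; exact: ltW.
by move=> /(_ k (leqnn k)) h tt0; apply: h => //; rewrite b1.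
Qed.

Lemma cone_derive1 t : 0 <= t <= 1 -> ~ breaks t -> cone I1 I2 (s t) (derive1 s t).
Proof.
move=> t01 nt; apply: s_timelike; left.
have t1 : t < 1.
  by move: (not_break nt (leqnn k)); rewrite b1 lt_neqAle => ->; case/andP: t01.
split; first by case/andP: t01 => ->.
have sd : is_derive t 1 s (derive1 s t).
  by apply: DeriveDef; [exact: derivable_off_breaks|rewrite derive1E].
by have [] := is_derive_sides sd.
Qed.

Lemma funk_length_le u : supports I2 u -> 0 < dot (s 1) u ->
  (funk_length I2 s <= (ln (dot (s 0) u) - ln (dot (s 1) u))%:E)%E.
Proof.
move=> su s1; have pos t : 0 <= t <= 1 -> 0 < dot (s t) u.
  by move=> /andP[t0 t1]; apply: (timelike_positive su t0 t1).
have [f [mf fE <-]] := integral_ln_pieces pos.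
have [mN N0] := breaks_null.
rewrite /funk_length; apply: (@le_integral_off_null _ _ R mu _ breaks) => //; first exact/measurable_EFinP.
move=> t /=; rewrite in_itv/= => t01 nt; rewrite fE//.
apply: funk_functional_le => //; [exact/Omega_sphere/sO| |exact: pos].
by apply: cone_tangent; exact: cone_derive1.
Qed.

(** If some velocity is nonzero, its chord supplies a u that is positive at that point, hence at s 0
    = s 1 by backward propagation, and the two logarithms cancel. Otherwise the functional vanishes
    off the break points. *)
Lemma funk_length_loop_le0 : s 0 = s 1 -> (funk_length I2 s <= 0)%E.
Proof.
move=> s01.
have [[t [t01 nt d0]]|none] :=
    pselect (exists t, [/\ 0 <= t <= 1, ~ breaks t & derive1 s t <> 0]).
  have [bb [c ch]] := cone_chord I1s I2_convex good (Omega_sphere (sO t01)) (cone_derive1 t01 nt) d0.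
  have [u [m [su m0 dotu]]] := chord_support I2_neq0 I2_open I2_convex ch.
  have [[_ _ c1 c2 c3] _ _ _ _] := ch.
  have pt : 0 < dot (s t) u.
    rewrite -(geod0 (s t) ((enorm (derive1 s t))^-1 *: derive1 s t)) dotu subr0.
    by rewrite mulr_gt0// sin_gt0_pi//; apply/andP; split; lra.
  have [t0 t1] := andP t01.
  have p1 : 0 < dot (s 1) u.
    by rewrite -s01; apply: (timelike_positive su _ t0 t1 pt).
  by have := funk_length_le su p1; rewrite s01 subrr.
have [mN N0] := breaks_null.
rewrite -(integral0 mu `[0%R, 1%R]%classic).
rewrite /funk_length; apply: (@le_integral_off_null _ _ R mu _ breaks) => // t /=; rewrite in_itv/= => t01 nt.
have -> : derive1 s t = 0.
  by apply: contrapT => d0; apply: none; exists t.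
by rewrite /funk_functional eqxx.
Qed.

End Pieces.

End Curve.

(** * The chord as a timelike curve, and its length *)

Section GeodesicCurve.
Context {R : realType} {n : nat}.
Local Notation E := 'rV[R]_n.+1.
Variables I1 I2 : set E.
Hypotheses (I2_neq0 : I2 !=set0) (I2_convex : sconvex I2).
Implicit Types (x p v : E) (b c r t : R).
Local Notation mu := (@lebesgue_measure R).

Lemma is_derive_scale (f : R -> R) x t (df : R) :
  is_derive t 1 f df -> is_derive t 1 (fun t => f t *: x) (df *: x).
Proof.
move=> [/cvg_ex[l fl] fv].
have {}fv : l = df by rewrite -fv; apply/esym; exact: cvg_lim fl.
have h : h^-1 *: (f (h *: 1 + t) *: x - f t *: x) @[h --> 0^'] --> df *: x.
  have -> : (fun h : R => h^-1 *: (f (h *: 1 + t) *: x - f t *: x)) =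
            (fun h => (h^-1 *: (f (h *: 1 + t) - f t)) *: x).
    by apply/funext => h; rewrite -scalerBl scalerA.
  by rewrite -fv; apply: cvgZr_tmp.
apply: DeriveDef; first by apply/cvg_ex; exists (df *: x).
by apply: cvg_lim h.
Qed.

Lemma is_derive_linear r t : is_derive t 1 (fun t => r * t) r.
Proof. by have := is_deriveZ r (@is_derive_id _ _ t 1); rewrite [r *: 1]mulr1. Qed.

Lemma is_derive_geod p v r t :
  is_derive t 1 (fun t => geod p v (r * t)) (r *: geod_velocity p v (r * t)).
Proof.
have -> : r *: geod_velocity p v (r * t) =
    (- sin (r * t) * r) *: p + (cos (r * t) * r) *: v.
  by rewrite scalerDr !scalerA !(mulrC r).
apply: is_deriveD; apply: is_derive_scale.
- exact: (is_derive1_comp (is_derive_cos (r * t)) (is_derive_linear r t)).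
- exact: (is_derive1_comp (is_derive_sin (r * t)) (is_derive_linear r t)).
Qed.

Lemma geod_timelike_curve p v b c r : chord I1 I2 p v b c -> 0 < r < c ->
  timelike_curve I1 I2 p (geod p v r) (fun t => geod p v (r * t)).
Proof.
move=> ch /andP[r0 rc]; have [[pp pv b0 c0 bc] _ _ O _] := ch.
have inbc t : 0 <= t <= 1 -> - b < r * t < c.
  move=> /andP[t0 t1]; apply/andP; split.
    by apply: (@lt_le_trans _ _ 0); [rewrite oppr_lt0|rewrite mulr_ge0// ltW].
  by apply: le_lt_trans rc; rewrite ger_pMr.
have cn t : 0 <= t <= 1 ->
    cone I1 I2 (geod p v (r * t)) (r *: geod_velocity p v (r * t)).
  by move=> /inbc h; exact: chord_cone (chord_shift ch h) r0.
split.
- by rewrite mulr0 geod0.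
- by rewrite mulr1.
- by move=> t /inbc; exact: O.
- exists 1%N, (fun i => i%:R); split => // i; rewrite ltnS leqn0 => /eqP->.
  split; first exact: ltr01.
  exists (fun t => r *: geod_velocity p v (r * t)); split.
  + apply: continuous_subspaceT => t; apply: cvgZl_tmp.
    have cr : {for t, continuous (fun t : R => r * t)} by exact: mulrl_continuous.
    apply: cvgD; apply: cvgZr_tmp.
    * by apply: cvgN; apply: (continuous_comp cr); exact: continuous_sin.
    * by apply: (continuous_comp cr); exact: continuous_cos.
  + by move=> t _; have [] := is_derive_sides (is_derive_geod p v r t).
  + by move=> t _; have [] := is_derive_sides (is_derive_geod p v r t).
- move=> t w; have [sr sl] := is_derive_sides (is_derive_geod p v r t).
  case=> -[/andP[t0 t1] sw].
    have -> : w = r *: geod_velocity p v (r * t).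
      exact: (cvg_unique (@norm_hausdorff _ _) sw sr).
    by apply: cn; rewrite t0 ltW.
  have -> : w = r *: geod_velocity p v (r * t).
    exact: (cvg_unique (@norm_hausdorff _ _) sw sl).
  by apply: cn; rewrite t1 ltW.
Qed.

(** At time t the arc left to K2 is c - r t, so the functional is at least r cot (c - r t), whose
    primitive is - ln sin (c - r t). *)
Lemma funk_length_geod p v b c r : chord I1 I2 p v b c -> 0 < r < c ->
  ((ln (sin c) - ln (sin (c - r)))%:E <=
   funk_length I2 (fun t => geod p v (r * t)))%E.
Proof.
move=> ch /andP[r0 rc]; have [[pp pv b0 c0 bc] _ _ O _] := ch.
have inbc t : 0 <= t <= 1 -> - b < r * t < c.
  move=> /andP[t0 t1]; apply/andP; split.
    by apply: (@lt_le_trans _ _ 0); [rewrite oppr_lt0|rewrite mulr_ge0// ltW].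
  by apply: le_lt_trans rc; rewrite ger_pMr.
have spos t : 0 <= t <= 1 -> 0 < sin (c - r * t).
  by move=> /inbc /andP[h1 h2]; apply: sin_gt0_pi; apply/andP; split; lra.
pose h t := r * (cos (c - r * t) / sin (c - r * t)).
pose F t := - ln (sin (c - r * t)).
have argd t : is_derive t 1 (fun t => c - r * t) (- r).
  have := is_deriveB (is_derive_cst c t (1 : R)) (is_derive_linear r t).
  by rewrite sub0r.
have sind t : is_derive t 1 (fun t => sin (c - r * t)) (cos (c - r * t) * (- r)).
  exact: (@is_derive1_comp R (@sin R) (fun t => c - r * t) t _ _ (is_derive_sin _) (argd t)).
have cosd t : is_derive t 1 (fun t => cos (c - r * t)) (- sin (c - r * t) * (- r)).
  exact: (@is_derive1_comp R (@cos R) (fun t => c - r * t) t _ _ (is_derive_cos _) (argd t)).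
have der_cont (f : R -> R) t (l : R) : is_derive t 1 f l -> {for t, continuous f}.
  by move=> [fd _]; apply: differentiable_continuous; exact/derivable1_diffP.
have ch' : {within `[(0 : R), 1], continuous h}.
  apply: continuous_in_subspaceT => t; rewrite inE/= in_itv/= => t01.
  apply: cvgZl_tmp; apply: cvgM; first exact: der_cont (cosd t).
  by apply: cvgV; [rewrite gt_eqF// spos|exact: der_cont (sind t)].
have Fd t : 0 <= t <= 1 -> is_derive t 1 F (h t).
  move=> t01; have -> : h t = - ((sin (c - r * t))^-1 * (cos (c - r * t) * (- r))).
    by rewrite /h; ring.
  exact: is_deriveN (is_derive1_comp (is_derive1_ln (spos t t01)) (sind t)).
have FE : (\int[mu]_(t in `[0%R, 1%R]) (h t)%:E = (F 1)%:E - (F 0)%:E)%E.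
  apply: continuous_FTC2 => //.
  - split.
    + by move=> t; rewrite in_itv/= => /andP[h1 h2]; have [] // := Fd t;
        rewrite !ltW.
    + apply: cvg_at_right_filter; apply: der_cont; apply: Fd.
      by rewrite lexx ler01.
    + apply: cvg_at_left_filter; apply: der_cont; apply: Fd.
      by rewrite lexx ler01.
  - move=> t; rewrite in_itv/= => /andP[h1 h2]; rewrite derive1E.
    by have [] : is_derive t 1 F (h t) by apply: Fd; rewrite !ltW.
have -> : (ln (sin c) - ln (sin (c - r)))%:E = ((F 1)%:E - (F 0)%:E)%E.
  by rewrite -EFinB /F mulr0 subr0 mulr1 opprK addrC.
rewrite -FE /funk_length; apply: le_integral_nonmeasurable => t /=.
rewrite in_itv/= => t01; rewrite derive1E.
have [_ ->] := is_derive_geod p v r t.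
exact: (funk_functional_chord_ge _ _ (chord_shift ch (inbc t t01)) r0).
Qed.

Lemma constant_timelike_curve p : Omega I1 I2 p ->
  timelike_curve I1 I2 p p (fun=> p).
Proof.
move=> Op.
have q0 : (fun h : R => h^-1 *: (p - p)) = (fun=> 0 : E).
  by apply/funext => h; rewrite subrr scaler0.
have r0 t : is_rderiv (fun=> p) t 0 by rewrite /is_rderiv q0; exact: cvg_cst.
have l0 t : is_lderiv (fun=> p) t 0 by rewrite /is_lderiv q0; exact: cvg_cst.
split => //.
- exists 1%N, (fun i => i%:R); split => // i; rewrite ltnS leqn0 => /eqP->.
  split; first exact: ltr01.
  by exists (fun=> 0); split => //; apply: continuous_subspaceT => t; exact: cvg_cst.
- move=> t w tw; left; case: tw => -[_ sw].
  + exact: (cvg_unique (@norm_hausdorff _ _) sw (r0 t)).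
  + exact: (cvg_unique (@norm_hausdorff _ _) sw (l0 t)).
Qed.

Lemma funk_length_constant p : funk_length I2 (fun=> p) = 0%E.
Proof.
rewrite /funk_length; apply: integral0_eq => t _.
by rewrite derive1_cst /funk_functional eqxx.
Qed.

End GeodesicCurve.

Theorem theorem12p6 (R : realType) (n : nat) (I1 I2 : set 'rV[R]_n.+1)
    (I1_neq0 : I1 !=set0) (I1_open : sopen I1) (I1_convex : sconvex I1)
    (I2_neq0 : I2 !=set0) (I2_open : sopen I2) (I2_convex : sconvex I2)
    (good : good_position I1 I2) (p q : 'rV[R]_n.+1)
    (Omega_p : Omega I1 I2 p) (Omega_q : Omega I1 I2 q)
    (le_pq : preceq I1 I2 p q) :
  (funk I2 p q)%:E = intrinsic_dist I1 I2 p q.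
Proof.
have [I1s _ _] := I1_convex.
apply/eqP; rewrite eq_le; apply/andP.
(* For equal points the constant curve gives one inequality and the estimate for loops the other. *)
have [pq|/eqP pq] := eqVneq p q.
  rewrite -pq /funk eqxx; split.
    apply: ereal_sup_ubound; exists (fun=> p); last exact: funk_length_constant.
    exact: constant_timelike_curve.
  apply: ge_ereal_sup => _ [s [s0 s1 sO [k [b [b0 b1 pieces]]] st] <-].
  by apply: (funk_length_loop_le0 _ _ _ _ _ b0 b1 pieces sO st) => //; rewrite s0 s1.
have /(prec_chord I1s I2_convex good) [v [b [c [r [ch rc qE]]]]] : prec I1 I2 p q.
  by case: le_pq.
have [[_ _ b0 c0 bc] _ _ _ _] := ch; have [r0 rc'] := andP rc.
have sc : 0 < sin c by apply: sin_gt0_pi; apply/andP; split; lra.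
have scr : 0 < sin (c - r) by apply: sin_gt0_pi; apply/andP; split; lra.
rewrite qE (funk_chord ch rc) ln_div ?posrE//; split.
  apply: le_trans (funk_length_geod I2_neq0 I2_convex ch rc) _.
  apply: ereal_sup_ubound; exists (fun t => geod p v (r * t)) => //.
  exact: (geod_timelike_curve ch rc).
have [u [m [su m0 dotu]]] := chord_support I2_neq0 I2_open I2_convex ch.
apply: ge_ereal_sup => _ [s [s0 s1 sO [k [d [d0 d1 pieces]]] st] <-].
have := funk_length_le I1s I2_neq0 I2_convex good d0 d1 pieces sO st su.
(* The factor m is common to <p, u> and <q, u>, and cancels in the difference of logarithms. *)
have pu : dot p u = m * sin c by rewrite -{1}(geod0 p v) dotu subr0.
rewrite s0 s1 dotu pu => /(_ (mulr_gt0 m0 scr)).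
by rewrite !lnM ?posrE// opprD addrACA subrr add0r.
Qed.
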